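(* Let $d\ge 4$, $n\ge d+2$, and let $f:[1,\infty)^2\to\mathbb{R}$ be a symmetric function, $f(x,y)=f(y,x)$, satisfying: (i) $f(x,y)$ is strictly increasing in $x$; (ii) $f(x+1,y-1)>f(x,y)$ whenever $x\ge y\ge 2$; (iii) the functions $x\mapsto f(1,x)$ and $x\mapsto f(2,x)$ are strictly convex (downward); (iv) $\phi(x,y)=f(x,y)-f(x-1,y)$ (for $x\ge 2$, $y\ge 1$) is strictly increasing in $x$ and strictly decreasing in $y$. Then for every $G\in\mathbb{U}_{n,d}$, $$\mathrm{BID}(G)\le \mathrm{BID}(\mathcal{U}_{n,d}),$$ with equality if and only if $G\cong \mathcal{U}_{n,d}$.
   Context: All graphs are finite, simple, undirected and connected; $d(u)$ is the degree of the vertex $u$. For a symmetric real-valued function $f$, the bond incident degree index of a graph $G$ is $\mathrm{BID}(G)=\sum_{uv\in E(G)} f(d(u),d(v))$. A unicyclic graph is a connected graph containing exactly one cycle; $\mathbb{U}_{n,d}$ is the set of unicyclic graphs with $n$ vertices and diameter $d$. For $d\ge 4$ and $n\ge d+2$, $\mathcal{U}_{n,d}$ is the graph obtained from a path $v_1v_2\ldots v_{d+1}$ by joining $v_2$ and $v_4$ by a path $P_3$ on three vertices whose two end vertices are $v_2$ and $v_4$ (i.e. adding one new vertex $w$ adjacent to exactly $v_2$ and $v_4$), and attaching $n-d-2$ pendant vertices (new vertices of degree 1) to $v_2$. *)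

(* Defs.v *)
From HB Require Import structures.
From mathcomp Require Import all_boot all_order all_algebra.
From mathcomp Require Import reals.

Set Implicit Arguments.
Unset Strict Implicit.
Unset Printing Implicit Defensive.

Import Order.TTheory GRing.Theory Num.Theory.
Local Open Scope ring_scope.

Record sgraph := SGraph {
  vertex :> finType;
  adj : rel vertex;
  adj_sym : symmetric adj;
  adj_irr : irreflexive adj
}.

Definition deg (G : sgraph) (u : G) : nat := #|[set v | adj u v]|.

Definition connected (G : sgraph) : Prop :=
  forall u v : G, connect (@adj G) u v.

(* The least k such that there is a walk with k edges from u to v.
   In a connected graph such a k < #|G| exists; otherwise the value is #|G|. *)
Definition dist (G : sgraph) (u v : G) : nat :=
  find (fun k => [exists p : k.-tuple G, path (@adj G) u p && (last u p == v)])
       (iota 0 #|G|).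

Definition diameter (G : sgraph) : nat :=
  (\max_(u : G) \max_(v : G) dist u v)%N.

(* A cycle is a subgraph, hence is identified with its set of edges: different
   rotations or orientations of the same cyclic sequence are one cycle. *)
Definition is_cycle (G : sgraph) (C : {set {set G}}) : Prop :=
  exists c : seq G,
    [/\ ucycle (@adj G) c, (2 < size c)%N
      & C = [set [set x; next c x] | x in c]].

Definition unicyclic (G : sgraph) : Prop :=
  connected G /\ exists! C : {set {set G}}, is_cycle C.

Definition unicyclic_nd (n d : nat) (G : sgraph) : Prop :=
  [/\ unicyclic G, #|G| = n & diameter G = d].

Definition isomorphic (G H : sgraph) : Prop :=
  exists2 h : G -> H, bijective h & forall u v, adj (h u) (h v) = adj u v.

(* Each edge {u, v} is summed once, through its orientation that is increasing
   for the enumeration of the vertices. *)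
Definition BID (R : realType) (f : R -> R -> R) (G : sgraph) : R :=
  \sum_(e : G * G | adj e.1 e.2 && (enum_rank e.1 < enum_rank e.2)%N)
    f (deg e.1)%:R (deg e.2)%:R.

(* Vertices: i <= d stands for v_(i+1), d.+1 for the vertex w joined to v_2 and
   v_4, and every i >= d.+2 for a pendant vertex attached to v_2. The values are
   meaningful only for d >= 4 and n >= d + 2. *)
Definition Und_arc (d i j : nat) : bool :=
  [|| (j == i.+1) && (j <= d)%N,
      (j == d.+1) && ((i == 1) || (i == 3))
    | (d.+2 <= j)%N && (i == 1)].

Definition Und_adj (n d : nat) : rel 'I_n :=
  [rel i j : 'I_n | (i != j) && (Und_arc d i j || Und_arc d j i)].

Lemma Und_sym n d : symmetric (@Und_adj n d).
Proof. by move=> i j; rewrite /Und_adj /= eq_sym orbC. Qed.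

Lemma Und_irr n d : irreflexive (@Und_adj n d).
Proof. by move=> i; rewrite /Und_adj /= eqxx. Qed.

Definition Und (n d : nat) : sgraph := SGraph (@Und_sym n d) (@Und_irr n d).

Definition strictly_convex_from1 (R : realType) (g : R -> R) : Prop :=
  forall x y t : R, 1 <= x -> 1 <= y -> x != y -> 0 < t < 1 ->
    g (t * x + (1 - t) * y) < t * g x + (1 - t) * g y.

Definition phi (R : realType) (f : R -> R -> R) (x y : R) : R :=
  f x y - f (x - 1) y.

(* Main.v *)
Require Import Defs.
From mathcomp Require Import all_boot all_order all_algebra.
From mathcomp Require Import reals.
From mathcomp Require Import zify lra ring.

Import Order.TTheory GRing.Theory Num.Theory.
Local Open Scope ring_scope.

(** The proof prunes pendant vertices away from a fixed diametral path P, inside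
    the given graph: a set S of vertices stands for the subgraph that it
    induces, and the induction is on its size ([part_weight_le]).  What the
    induction needs of S is that it contains P, is connected and has as many
    edges as vertices ([unicyclic_part]); removing a pendant vertex off P keeps
    all three.

    Put D = |S| - d + 1, the largest degree of U_{|S|,d}.  If a pendant vertex x
    off P hangs on a vertex y of degree k, removing x lowers the index by
    f(1,k) plus the sum of phi(k, deg z) over the other neighbours z of y.  In
    U_{|S|,d} the same step costs f(1,D) + (D-3) phi(D,1) + 2 phi(D,2).  This is
    at least as much, for two reasons: k <= D because a vertex has few
    neighbours on a geodesic ([part_dg_le]), and at most D-3 of the vertices z
    are pendant, because S contains d+1 vertices that are not pendant neighbours
    of y ([part_pendants]).  The comparison then follows from the monotonicity of
    f and phi ([pendant_gain]).

    Two cases have no such x.  If |S| = d+2, then S is P with one further vertex,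
    whose two neighbours on P are at distance 1 or 2; the indices of these few
    graphs are computed ([ear_weight]) and compared ([ear_weight_le]).  If
    |S| > d+2 and every pendant vertex lies on P, at most two vertices are
    pendant, so all degrees are at most 4 and the index is strictly below the
    bound ([core_weight]).  Both computations rest on one idea: compared with
    f(2,2), the weight of an edge is the sum of a contribution of each end and of
    a defect that vanishes as soon as one end has degree 2; the sum over the
    edges becomes a sum over the vertices, controlled by the identity
    sum (deg - 2) = 0 ([weight_deg_le3], [weight_deg_le4]).

    Equality propagates through the induction: in the case |S| = d+2 it leaves
    U_{d+2,d} only, and afterwards the vertex y must have degree D with D-3
    pendant neighbours besides x, which forces y to be the vertex v_2 (up to the
    symmetry that exchanges v_2 and v_4 when d = 4).

    That a unicyclic graph has as many edges as vertices is proved by removing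
    an edge of its cycle ([unicyclic_degree_sum]). *)

(** * Subgraphs induced by sets of vertices *)

Section Induced.
Set Implicit Arguments.
Unset Strict Implicit.
Local Open Scope nat_scope.
Variables (T : finType) (e : rel T).
Implicit Types (S A B : {set T}) (u v x y : T).

Definition nb S u : {set T} := [set v in S | e u v].

Definition dg S u : nat := #|nb S u|.

Lemma dg_card S u : dg S u = #|nb S u|. Proof. by []. Qed.

Definition degree_sum S : nat := \sum_(u in S) dg S u.

(** Connectedness of the induced subgraph. Stated with cuts, it passes to S
    minus a pendant vertex without rerouting any path. *)
Definition cut_connected S : Prop :=
  forall A, A \subset S -> A != set0 -> A != S ->
  exists u v, [/\ u \in A, v \in S, v \notin A & e u v].

Lemma dgE S u : dg S u = \sum_(v in S) e u v.
Proof.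
by rewrite /dg -sum1dep_card big_mkcondr /=; apply: eq_bigr => v _; case: (e u v).
Qed.

Lemma dgS A B u : A \subset B -> dg A u <= dg B u.
Proof.
move=> sAB; apply: subset_leq_card; apply/subsetP => v.
by rewrite !inE => /andP[/(subsetP sAB)-> ->].
Qed.

Lemma dg_setID A S u : A \subset S -> dg S u = dg A u + dg (S :\: A) u.
Proof.
move=> sAS; rewrite !dgE (big_setID A) /=; congr (_ + _).
by apply: eq_bigl => v; rewrite (setIidPr sAS).
Qed.

Hypotheses (e_sym : symmetric e) (e_irr : irreflexive e).

Lemma sum_dgC A B : \sum_(u in A) dg B u = \sum_(u in B) dg A u.
Proof.
under eq_bigr => u _ do rewrite dgE.
rewrite exchange_big /=; apply: eq_bigr => v _; rewrite dgE.
by apply: eq_bigr => u _; rewrite e_sym.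
Qed.

(** The edges inside A are counted twice, those that leave A once from each
    side. *)
Lemma degree_sum_setID A S : A \subset S ->
  degree_sum S = degree_sum A + \sum_(u in S :\: A) (dg A u + dg S u).
Proof.
move=> sAS; rewrite {1}/degree_sum (big_setID A) /= (setIidPr sAS).
under eq_bigr => u _ do rewrite (dg_setID u sAS).
by rewrite big_split /= sum_dgC -addnA big_split.
Qed.

Lemma dg_set1 x u : dg [set x] u = e u x.
Proof. by rewrite dgE big_set1. Qed.

Lemma dg_rem S x u : x \in S -> dg S u = dg (S :\ x) u + e u x.
Proof.
by move=> xS; rewrite (@dg_setID [set x]) ?sub1set// dg_set1 addnC.
Qed.

Lemma degree_sum_rem S x : x \in S ->
  degree_sum S = degree_sum (S :\ x) + (dg S x).*2.
Proof.
move=> xS; rewrite (@degree_sum_setID (S :\ x)) ?subD1set//; congr (_ + _).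
have -> : S :\: (S :\ x) = [set x].
  by apply/setP => v; rewrite !inE; case: eqP => [->|]; rewrite ?xS//; case: (v \in S).
by rewrite big_set1 (dg_rem x xS) e_irr addn0 addnn.
Qed.

(** A cut of S minus x extends to a cut of S by putting x on the side of its
    neighbour y; the crossing edge then avoids x. *)
Lemma cut_connected_rem S x y : x \in S -> nb S x = [set y] ->
  cut_connected S -> cut_connected (S :\ x).
Proof.
move=> xS nbx cS A sA A0 AS.
have exy : forall v, v \in S -> e x v -> v = y.
  by move=> v vS exv; apply/set1P; rewrite -nbx inE vS.
have xA : x \notin A by apply/negP => /(subsetP sA); rewrite !inE eqxx.
have sAS : A \subset S by apply: subset_trans sA (subD1set _ _).
have [yA|yA] := boolP (y \in A).
  have [|||u [v [uA vS vA euv]]] := cS (x |: A).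
  - by rewrite subUset sub1set xS.
  - by apply/set0Pn; exists x; rewrite !inE eqxx.
  - apply: contraNneq AS => <-; apply/eqP/setP => v; rewrite !inE.
    by case: eqP => // ->; rewrite (negPf xA).
  have : (v != x) && (v \notin A) by rewrite !inE negb_or in vA.
  case/andP=> vx vA'; exists u, v; split=> //; last first.
  - by rewrite !inE vx.
  have := uA; rewrite !inE => /orP[/eqP ux|//].
  by move: vA'; rewrite (exy v) ?yA // -ux.
have [|u [v [uA vS vA euv]]] := cS A sAS A0.
  by apply: contraNneq xA => ->.
exists u, v; split=> //; rewrite !inE vS andbT.
apply: contraNneq yA => vx; rewrite -(exy u) ?(subsetP sAS)//.
by rewrite -vx e_sym.
Qed.

Lemma dg_gt0 S u : cut_connected S -> 1 < #|S| -> u \in S -> 0 < dg S u.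
Proof.
move=> cS S1 uS; have [|||u' [v [/set1P-> vS _ euv]]] := cS [set u].
- by rewrite sub1set.
- by apply/set0Pn; exists u; rewrite inE.
- by apply: contraTneq S1 => <-; rewrite cards1.
by rewrite card_gt0; apply/set0Pn; exists v; rewrite inE vS.
Qed.

Lemma dg1_nb S x : dg S x = 1 -> exists y, nb S x = [set y].
Proof. by move/eqP/cards1P. Qed.

(** * Geodesics *)

(** A path p 0, ..., p d. Of the minimality of a shortest path only the
    absence of shortcuts of length 0, 1 and 2 is retained. *)
Definition geodesic (p : nat -> T) (d : nat) : Prop :=
  [/\ forall i, i < d -> e (p i) (p i.+1),
      forall i j, i <= d -> j <= d -> p i = p j -> i = j,
      forall i j, i <= d -> j <= d -> e (p i) (p j) -> j <= i.+1
    & forall x i j, i <= d -> j <= d -> e x (p i) -> e x (p j) -> j <= i.+2].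

Definition trace (p : nat -> T) (d : nat) : {set T} :=
  [set p i | i : 'I_d.+1].

Section OnGeodesic.
Variables (p : nat -> T) (d : nat).
Hypothesis geo : geodesic p d.

Lemma mem_trace i : i <= d -> p i \in trace p d.
Proof.
by move=> le; apply/imsetP; exists (Ordinal (le : i < d.+1)).
Qed.

Lemma traceP u : reflect (exists2 i, i <= d & u = p i) (u \in trace p d).
Proof.
apply: (iffP imsetP) => [[i _ ->]|[i le ->]]; first by exists i; rewrite // -ltnS.
by exists (Ordinal (le : i < d.+1)).
Qed.

Lemma geodesic_eq i j : i <= d -> j <= d -> (p i == p j) = (i == j).
Proof.
by case: geo => _ inj _ _ li lj; apply/eqP/eqP => [/inj->|->].
Qed.

Lemma card_trace : #|trace p d| = d.+1.
Proof.
rewrite card_imset ?card_ord // => i j /eqP.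
by rewrite geodesic_eq ?leq_ord // => /eqP/val_inj.
Qed.

Lemma geodesic_adj i j : i <= d -> j <= d ->
  e (p i) (p j) = (j == i.+1) || (i == j.+1).
Proof.
case: geo => adjp inj sc1 _ li lj; apply/idP/idP => [eij|].
  have ji := sc1 _ _ li lj eij.
  have ij : i <= j.+1 by apply: (sc1) => //; rewrite e_sym.
  have : i != j by apply: contraTneq eij => ->; rewrite e_irr.
  lia.
by case/orP => /eqP eqn; subst; [|rewrite e_sym]; apply: adjp.
Qed.

Lemma big_trace (R : Type) (idx : R) (op : Monoid.com_law idx) (F : T -> R) :
  \big[op/idx]_(u in trace p d) F u = \big[op/idx]_(i < d.+1) F (p i).
Proof.
rewrite big_imset //= => i j _ _ /eqP.
by rewrite geodesic_eq ?leq_ord // => /eqP/val_inj.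
Qed.

Lemma dg_trace i : i <= d -> dg (trace p d) (p i) = (0 < i) + (i < d).
Proof.
move=> li; rewrite dgE big_trace.
under eq_bigr => j _ do rewrite geodesic_adj ?leq_ord //.
rewrite (eq_bigr (fun j : 'I_d.+1 => (j == i.+1 :> nat) + (i == j.+1 :> nat))); last first.
  by move=> j _; lia.
rewrite big_split /= addnC; congr (_ + _).
- case: i li => [|i] li; first by rewrite big1.
  have lt : i < d.+1 by lia.
  rewrite (bigD1 (Ordinal lt)) //= eqxx big1 // => j.
  by rewrite -val_eqE /= eqSS eq_sym => /negPf->.
- have [lt|ge] := ltnP i d.
    have lt' : i.+1 < d.+1 by lia.
    rewrite (bigD1 (Ordinal lt')) //= eqxx big1 // => j.
    by rewrite -val_eqE /= => /negPf->.
  by rewrite big1 // => j _; have := ltn_ord j; lia.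
Qed.

Lemma degree_sum_trace : degree_sum (trace p d) = d.*2.
Proof.
rewrite /degree_sum big_trace.
rewrite (eq_bigr (fun i : 'I_d.+1 => (0 < i) + (i < d))) => [|i _]; last first.
  by rewrite dg_trace // leq_ord.
rewrite big_split /= big_ord_recl /= big_ord_recr /= ltnn add0n addn0.
rewrite -addnn; congr (_ + _).
  by rewrite (eq_bigr (fun=> 1)) ?sum1_card ?card_ord.
by rewrite (eq_bigr (fun=> 1)) ?sum1_card ?card_ord // => i _; rewrite ltn_ord.
Qed.

(** The neighbours of x on a geodesic lie in a window of three consecutive
    vertices, which starts at the first of them. *)
Lemma dg_trace_le3 x : dg (trace p d) x <= 3.
Proof.
rewrite dgE big_trace.
have [/existsP[i0 ei0]|/existsPn no] := boolP [exists i : 'I_d.+1, e x (p i)];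
    last by rewrite big1 // => i _; rewrite (negPf (no i)).
have := @arg_minnP 'I_d.+1 i0 (fun i => e x (p i)) val ei0.
case=> i ei mini.
have bnd (j : 'I_d.+1) : e x (p j) <= (j == i :> nat) + (j == i.+1 :> nat) + (j == i.+2 :> nat).
  case: (boolP (e x (p j))) => // ej.
  have ij : (i : nat) <= j by exact: mini.
  case: geo => _ _ _ sc2; have := sc2 x i j (leq_ord _) (leq_ord _) ei ej.
  by lia.
have one (k : nat) : \sum_(j < d.+1) (j == k :> nat) <= 1.
  rewrite -big_mkcond /= sum1dep_card; apply/card_le1_eqP => j1 j2.
  by rewrite !inE => /eqP j1k /eqP j2k; apply: val_inj; rewrite /= j1k.
apply: (leq_trans (@leq_sum _ _ xpredT _ _ (fun j _ => bnd j))).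
rewrite !big_split /=.
exact: (leq_add (leq_add (one i) (one i.+1)) (one i.+2)).
Qed.

End OnGeodesic.

Lemma geodesic_rev p d : geodesic p d -> geodesic (fun i => p (d - i)) d.
Proof.
case=> adjp inj sc1 sc2; split=> [i lt|i j li lj /inj|i j li lj eij|x i j li lj exi exj].
- by rewrite e_sym; have := adjp (d - i.+1); rewrite -subSn // subSS; apply; lia.
- by move/(_ (leq_subr _ _) (leq_subr _ _)); lia.
- rewrite e_sym in eij; have := sc1 _ _ (leq_subr _ _) (leq_subr _ _) eij; lia.
- have := sc2 x _ _ (leq_subr _ _) (leq_subr _ _) exj exi; lia.
Qed.

End Induced.

(** * The index as a function of induced subgraphs *)

Section Weight.
Set Implicit Arguments.
Unset Strict Implicit.
Variables (R : realFieldType) (g : nat -> nat -> R).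

Definition inc i j : R := g i j - g i.-1 j.

(** The hypotheses on the edge weight f, read at integral degrees, with [inc]
    in the place of phi. *)
Record escalating : Prop := Escalating {
  esc_sym : forall i j, (0 < i)%N -> (0 < j)%N -> g i j = g j i;
  esc_incr : forall i i' j, (0 < i)%N -> (0 < j)%N -> (i < i')%N ->
    g i j < g i' j;
  esc_shift : g 2 2 < g 3 1;
  esc_inc_incr : forall i i' j, (1 < i)%N -> (0 < j)%N -> (i < i')%N ->
    inc i j < inc i' j;
  esc_inc_decr : forall i j j', (1 < i)%N -> (0 < j)%N -> (j < j')%N ->
    inc i j' < inc i j }.

(** An edge with ends of degrees i and j weighs
    g 2 2 + alpha i + alpha j + corr i j, and corr i j is 0 when i or j is 2. *)
Definition alpha k : R := g 2 k - g 2 2.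
Definition corr i j : R := g i j - g 2 i - g 2 j + g 2 2.
Definition beta k : R := corr 1 k.

Hypothesis esc : escalating.

Lemma inc_gt0 i j : (1 < i)%N -> (0 < j)%N -> 0 < inc i j.
Proof. by case: i => // i i1 j0; rewrite subr_gt0; apply: (esc_incr esc). Qed.

Lemma inc_lel i i' j : (1 < i)%N -> (0 < j)%N -> (i <= i')%N -> inc i j <= inc i' j.
Proof.
move=> i1 j0; rewrite leq_eqVlt => /orP[/eqP->//|lt].
by apply/ltW; apply: (esc_inc_incr esc).
Qed.

Lemma inc_ler i j j' : (1 < i)%N -> (0 < j)%N -> (j <= j')%N -> inc i j' <= inc i j.
Proof.
move=> i1 j0; rewrite leq_eqVlt => /orP[/eqP->//|lt].
by apply/ltW; apply: (esc_inc_decr esc).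
Qed.

Lemma corrC i j : (0 < i)%N -> (0 < j)%N -> corr i j = corr j i.
Proof. by move=> i0 j0; rewrite /corr (esc_sym esc i0 j0); ring. Qed.

Lemma alpha2 : alpha 2 = 0. Proof. exact: subrr. Qed.

Lemma beta2 : beta 2 = 0.
Proof. by rewrite /beta /corr (@esc_sym esc 1 2) //; ring. Qed.

(** This form makes beta monotone and positive beyond 2. *)
Lemma betaE k : (0 < k)%N -> beta k = inc 2 2 - inc 2 k.
Proof.
by move=> k0; rewrite /beta /corr /inc (@esc_sym esc 2 1) //=; ring.
Qed.

Lemma beta_le k k' : (0 < k)%N -> (k <= k')%N -> beta k <= beta k'.
Proof.
move=> k0 kk'; rewrite !betaE ?(leq_trans k0)// lerD2l lerN2.
exact: inc_ler.
Qed.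

Lemma beta_gt0 k : (2 < k)%N -> 0 < beta k.
Proof.
by move=> k2; rewrite betaE ?(ltn_trans _ k2)// subr_gt0 (esc_inc_decr esc).
Qed.

Lemma corr33_lt0 : corr 3 3 < 0.
Proof.
have := @esc_inc_decr esc 3 2 3 isT isT isT.
by rewrite /inc /corr /= (@esc_sym esc 3 2) //; lra.
Qed.

Lemma corr_le0 i j : (2 <= i <= 4)%N -> (2 <= j <= 4)%N -> corr i j <= 0.
Proof.
have h33 := corr33_lt0.
have c2 k : (0 < k)%N -> corr 2 k = 0.
  by move=> k0; rewrite /corr; lra.
have h34 : corr 3 4 < 0.
  have := @esc_inc_decr esc 3 2 4 isT isT isT.
  by rewrite /inc /corr /= (@esc_sym esc 3 2) //; lra.
have h44 : corr 4 4 < corr 3 4.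
  have := @esc_inc_decr esc 4 2 4 isT isT isT.
  by rewrite /inc /corr /= (@esc_sym esc 4 2) // (@esc_sym esc 3 2) //; lra.
move: i j => [|[|[|[|[|i]]]]] // [|[|[|[|[|j]]]]] // _ _.
- by rewrite c2.
- by rewrite c2.
- by rewrite c2.
- by rewrite corrC // c2.
- exact: ltW.
- exact: ltW.
- by rewrite corrC // c2.
- by rewrite corrC // ltW.
- by apply/ltW/(lt_trans h44).
Qed.

Lemma alpha1_lt : - alpha 1 < alpha 3.
Proof.
have := @esc_inc_incr esc 2 3 2 isT isT isT.
by rewrite /inc /alpha /= (@esc_sym esc 3 2) // (@esc_sym esc 1 2) //; lra.
Qed.

Lemma alpha3_lt4 : alpha 3 < alpha 4.
Proof.
by rewrite /alpha ltrD2r (@esc_sym esc 2 3) // (@esc_sym esc 2 4) // (esc_incr esc).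
Qed.

Lemma alpha3_gt0 : 0 < alpha 3.
Proof.
by rewrite /alpha (@esc_sym esc 2 3) // subr_gt0 (esc_incr esc).
Qed.

Variables (T : finType) (e : rel T).
Hypotheses (e_sym : symmetric e) (e_irr : irreflexive e).
Implicit Types (S : {set T}) (u v x y : T).
Local Notation dg := (dg e).
Local Notation nb := (nb e).

(** Both orientations of an edge are summed, so that this is twice the index:
    the double sum can be exchanged and needs no order on the vertices. *)
Definition weight S : R :=
  \sum_(u in S) \sum_(v in S | e u v) g (dg S u) (dg S v).

Lemma arc_sumC S (B : T -> T -> R) :
  \sum_(u in S) \sum_(v in S | e u v) B v u =
  \sum_(u in S) \sum_(v in S | e u v) B u v.
Proof.
rewrite (exchange_big_dep (mem S)) //=; last by move=> u v _ /andP[].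
apply: eq_bigr => u uS; apply: eq_bigl => v.
by rewrite [v \in S]lock; rewrite -lock e_sym uS.
Qed.

(** A contribution of the ends of the edges is collected at the vertices. *)
Lemma arc_sum_const S (A : T -> R) :
  \sum_(u in S) \sum_(v in S | e u v) A u = \sum_(u in S) (dg S u)%:R * A u.
Proof.
apply: eq_bigr => u _.
by rewrite sumr_const mulr_natl; congr (_ *+ _); apply: eq_card => v; rewrite !inE.
Qed.

Lemma dg_nb_gt0 S u v : v \in S -> e u v -> (0 < dg S u)%N.
Proof. by move=> vS euv; rewrite card_gt0; apply/set0Pn; exists v; rewrite inE vS. Qed.

(** Deleting the pendant vertex x changes only one other degree, that of its
    neighbour y: apart from the edge xy, the edges at y alone change weight. *)
Lemma weight_rem S x y : x \in S -> nb S x = [set y] ->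
  weight S = weight (S :\ x) +
    2 * (g 1 (dg S y) + \sum_(z in nb (S :\ x) y) inc (dg S y) (dg S z)).
Proof.
move=> xS nbx.
have dx : dg S x = 1%N by rewrite dg_card nbx cards1.
have /andP[yS exy] : (y \in S) && e x y by have : y \in nb S x; [rewrite nbx set11|rewrite inE].
have exE v : v \in S -> e x v = (v == y).
  by move=> vS; rewrite -(in_set1 v y) -nbx inE vS.
have yx : y != x by apply: contraTneq exy => ->; rewrite e_irr.
have yS' : y \in S :\ x by rewrite !inE yx.
pose k := dg S y; pose S' := S :\ x.
have dS' u : u \in S' -> dg S u = (dg S' u + (u == y))%N.
  by case/setD1P => ux uS; rewrite (dg_rem e u xS) e_sym exE.
pose H u v : R := if e u v then g (dg S u) (dg S v) else 0.
pose H' u v : R := if e u v then g (dg S' u) (dg S' v) else 0.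
pose I u v : R := if e u v && (u == y) then inc k (dg S v) else 0.
rewrite -/k -/S'; set Y := \sum_(z in nb S' y) _.
have -> : weight S = \sum_(u in S) \sum_(v in S) H u v.
  by apply: eq_bigr => u _; rewrite big_mkcondr.
have -> : weight S' = \sum_(u in S') \sum_(v in S') H' u v.
  by apply: eq_bigr => u _; rewrite big_mkcondr.
have Hsym u v : u \in S -> v \in S -> H u v = H v u.
  move=> uS vS; rewrite /H e_sym; case: ifP => // evu.
  by rewrite (esc_sym esc) ?(dg_nb_gt0 uS evu)// (@dg_nb_gt0 _ _ v)// e_sym.
(* An edge of S minus x changes weight if y is its first or its second end. *)
have HE u v : u \in S' -> v \in S' -> H u v = H' u v + (I u v + I v u).
  move=> uS' vS'; rewrite /H /H' /I (e_sym v u); case: ifP => [euv|_] /=; last by rewrite !addr0.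
  have v0 : (0 < dg S' v)%N by apply: (dg_nb_gt0 uS'); rewrite e_sym.
  have u0 : (0 < dg S' u)%N by apply: (dg_nb_gt0 vS').
  rewrite (dS' u)// (dS' v)// /inc /k (dS' y yS') eqxx.
  have [uy|uy] := eqVneq u y; have [vy|vy] := eqVneq v y.
  - by move: euv; rewrite uy vy e_irr.
  - by rewrite uy !addn0 addn1 /=; ring.
  - rewrite vy !addn0 addn1 /=.
    by rewrite (@esc_sym esc _ (dg S' y).+1)// (@esc_sym esc _ (dg S' y)) -?vy //; ring.
  - by rewrite !addn0 !addr0.
have hx : \sum_(v in S') H x v = g 1 k.
  rewrite (bigD1 y) //= {1}/H exy dx big1 ?addr0 // => v /andP[/setD1P[_ vS] vy].
  by rewrite /H exE // (negPf vy).
rewrite (big_setD1 x) //= (big_setD1 x) //= {1}/H e_irr add0r hx.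
under eq_bigr => u uS' do rewrite (big_setD1 x) //=.
rewrite big_split /= (eq_bigr (H x)) => [|u /setD1P[_ uS]]; last by rewrite Hsym.
rewrite hx; under [X in _ + (_ + X)]eq_bigr => u uS' do
  under eq_bigr => v vS' do rewrite HE //.
under [X in _ + (_ + X)]eq_bigr => u uS' do rewrite !big_split /=.
rewrite !big_split /= [X in _ + (_ + (_ + (_ + X)))]exchange_big /=.
have -> : \sum_(u in S') \sum_(v in S') I u v = \sum_(z in nb S' y) inc k (dg S z).
  rewrite (bigD1 y) //= [X in _ + X]big1 ?addr0.
    rewrite -big_mkcondr /=; apply: eq_bigl => v.
    by rewrite !inE eqxx andbT.
  by move=> u /andP[_ uy]; rewrite big1 // => v _; rewrite /I (negPf uy) andbF.
by rewrite -/Y -/k -/S'; ring.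
Qed.

(** Among the degrees 1, 2, 3 only the pairs 1-3 and 3-3 have a defect [corr]
    (1-1 is excluded). As the sum of deg - 2 is 0, there are as many vertices of
    degree 3 as pendant ones, so each pendant vertex can be charged the
    contribution 3 * alpha 3 of one vertex of degree 3. *)
Lemma weight_deg_le3 S :
  (forall u, u \in S -> 0 < dg S u <= 3)%N ->
  (forall u v, u \in S -> v \in S -> e u v -> dg S u = 1%N -> dg S v != 1%N) ->
  degree_sum e S = (#|S|).*2 ->
  weight S =
    2 * (#|S|%:R * g 2 2 + #|[set u in S | dg S u == 1%N]|%:R * (alpha 1 + 3 * alpha 3)
         + \sum_(u in S | dg S u == 1%N) \sum_(v in S | e u v) beta (dg S v))
    + \sum_(u in S) \sum_(v in S | e u v)
        (if (dg S u == 3%N) && (dg S v == 3%N) then corr 3 3 else 0).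
Proof.
move=> dle no11 sum2.
have s21 : g 2 1 = g 1 2 by apply: (esc_sym esc).
have s31 : g 3 1 = g 1 3 by apply: (esc_sym esc).
have s32 : g 3 2 = g 2 3 by apply: (esc_sym esc).
have [B BE] : exists B : T -> T -> R, forall u v,
    B u v = g 2 2 / 2 + alpha (dg S u) + (if dg S u == 1%N then beta (dg S v) else 0).
  by exists (fun u v => g 2 2 / 2 + alpha (dg S u) + (if dg S u == 1%N then beta (dg S v) else 0)).
have -> : weight S = \sum_(u in S) \sum_(v in S | e u v)
    (B u v + (B v u + if (dg S u == 3%N) && (dg S v == 3%N) then corr 3 3 else 0)).
  apply: eq_bigr => u uS; apply: eq_bigr => v /andP[vS euv].
  have := no11 u v uS vS euv; have := dle u uS; have := dle v vS.
  rewrite !BE; move: (dg S u) (dg S v) => [|[|[|[|i]]]] // [|[|[|[|j]]]] // _ _ /= n11;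
    by [have := n11 erefl | rewrite /beta /alpha /corr ?s21 ?s31 ?s32; field].
under eq_bigr => u _ do rewrite !big_split /=.
rewrite 2!big_split /= (arc_sumC S B) addrA; congr (_ + _).
have -> : \sum_(u in S) \sum_(v in S | e u v) B u v =
   \sum_(u in S) (dg S u)%:R * (g 2 2 / 2 + alpha (dg S u)) +
   \sum_(u in S | dg S u == 1%N) \sum_(v in S | e u v) beta (dg S v).
  rewrite -arc_sum_const [X in _ = _ + X]big_mkcondr -big_split /=.
  apply: eq_bigr => u _; under eq_bigr => v _ do rewrite BE.
  rewrite big_split /=; congr (_ + _).
  by case: ifP => // _; rewrite big1.
have -> : \sum_(u in S) (dg S u)%:R * (g 2 2 / 2 + alpha (dg S u)) =
   \sum_(u in S) ((dg S u)%:R * (g 2 2 / 2 + 3 * alpha 3) +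
     ((if dg S u == 1%N then alpha 1 + 3 * alpha 3 else 0) - 6 * alpha 3)).
  apply: eq_bigr => u /dle; move: (dg S u) => [|[|[|[|i]]]] // _ /=.
  - by field.
  - by rewrite alpha2; field.
  - by field.
rewrite !big_split /= -mulr_suml -natr_sum -/(degree_sum e S) sum2.
rewrite -big_mkcondr /= !sumr_const -muln2 natrM.
have -> : #|[pred u in S | dg S u == 1%N]| = #|[set u in S | dg S u == 1%N]|.
  by apply: eq_card => u; rewrite !inE.
rewrite -[(- (6 * _)) *+ _]mulr_natl -[(alpha 1 + _) *+ _]mulr_natl.
by field.
Qed.

(** The constant mu bounds the contribution (deg u) * alpha (deg u) of a vertex
    per unit of deg u - 2, and the sum of these excesses is the number of
    pendant vertices. The defect of an edge is positive only at a pendant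
    vertex, and is then at most beta 4. *)
Lemma weight_deg_le4 S mu :
  3 * alpha 3 <= mu -> 2 * alpha 4 <= mu ->
  (forall u, u \in S -> 0 < dg S u <= 4)%N ->
  (forall u v, u \in S -> v \in S -> e u v -> dg S u = 1%N -> dg S v != 1%N) ->
  degree_sum e S = (#|S|).*2 ->
  weight S <= 2 * (#|S|%:R * g 2 2 +
     #|[set u in S | dg S u == 1%N]|%:R * (alpha 1 + mu + beta 4)).
Proof.
move=> mu3 mu4 dle no11 sum2.
pose A u : R := g 2 2 / 2 + alpha (dg S u) + (if dg S u == 1%N then beta 4 else 0).
have : weight S <= \sum_(u in S) \sum_(v in S | e u v) (A u + A v).
  apply: ler_sum => u uS; apply: ler_sum => v /andP[vS euv].
  have := no11 u v uS vS euv; have := dle u uS; have := dle v vS.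
  rewrite /A; move: (dg S u) (dg S v) => i j dj di n11.
  have -> : g i j = g 2 2 / 2 + alpha i + (g 2 2 / 2 + alpha j) + corr i j.
    by rewrite /alpha /corr; field.
  have [i1|i1] := eqVneq i 1%N.
    have j1 := n11 i1; rewrite i1 (negPf j1).
    have : beta j <= beta 4 by apply: beta_le; lia.
    by rewrite /beta; lra.
  have [j1|j1] := eqVneq j 1%N.
    have : beta i <= beta 4 by apply: beta_le; lia.
    by rewrite j1 corrC /beta; [lra|lia|].
  have : corr i j <= 0 by apply: corr_le0; lia.
  by lra.
move/le_trans; apply.
under eq_bigr => u _ do rewrite big_split /=.
rewrite big_split /= (arc_sumC S (fun u v => A u)) arc_sum_const.
have : \sum_(u in S) (dg S u)%:R * A u <=
   \sum_(u in S) ((dg S u)%:R * (g 2 2 / 2 + mu) +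
     ((if dg S u == 1%N then alpha 1 + mu + beta 4 else 0) - 2 * mu)).
  apply: ler_sum => u /dle; rewrite /A; move: (dg S u) => [|[|[|[|[|i]]]]] // _ /=.
  - by lra.
  - by rewrite alpha2; lra.
  - by lra.
  - by lra.
rewrite !big_split /= -mulr_suml -natr_sum -/(degree_sum e S) sum2.
rewrite -big_mkcondr /= !sumr_const -muln2 natrM.
have -> : #|[pred u in S | dg S u == 1%N]| = #|[set u in S | dg S u == 1%N]|.
  by apply: eq_card => u; rewrite !inE.
rewrite -[(- (2 * mu)) *+ _]mulr_natl -[(alpha 1 + _ + _) *+ _]mulr_natl.
by lra.
Qed.

End Weight.

Section Bound.
Set Implicit Arguments.
Unset Strict Implicit.
Variables (R : realFieldType) (g : nat -> nat -> R) (esc : escalating g).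
Local Notation alpha := (alpha g).
Local Notation beta := (beta g).
Local Notation corr := (corr g).
Local Notation inc := (inc g).

(** The gain from a new pendant vertex at a vertex of degree k with a pendant
    and b other neighbours besides it, against the gain in the extremal graph
    on d + 3 + t vertices: there the degree is t + 4 and the neighbours besides
    the new one are t + 1 pendant vertices and two vertices of degree 2. A
    smaller degree or fewer pendant neighbours gain less, because [inc] is
    positive, increasing in its first and decreasing in its second argument. *)
Lemma pendant_gain k a b t : (a + b.+1 = k)%N -> (a <= t.+1)%N -> (k <= t + 4)%N ->
  g 1 k + a%:R * inc k 1 + b%:R * inc k 2 <= 
    g 1 (t + 4) + t.+1%:R * inc (t + 4) 1 + 2 * inc (t + 4) 2 /\
  (g 1 k + a%:R * inc k 1 + b%:R * inc k 2 =
    g 1 (t + 4) + t.+1%:R * inc (t + 4) 1 + 2 * inc (t + 4) 2 ->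
   k = (t + 4)%N /\ a = t.+1).
Proof.
move=> kE at1 kt; set X := inc (t + 4) 1; set Y := inc (t + 4) 2.
have Y0 : 0 < Y by apply: inc_gt0 => //; lia.
have XY : Y < X by apply: (esc_inc_decr esc) => //; lia.
have [s ts] : exists s, t.+1 = (a + s)%N by exists (t.+1 - a)%N; lia.
have [r tr] : exists r, (t.+1 + 2 = a + b + r)%N by exists (t + 3 - (a + b))%N; lia.
have s0 : 0 <= s%:R * (X - Y) by rewrite mulr_ge0 // subr_ge0 ltW.
have r0 : 0 <= r%:R * Y by rewrite mulr_ge0 // ltW.
have total : t.+1%:R * X + 2 * Y = a%:R * X + b%:R * Y + s%:R * (X - Y) + r%:R * Y.
  have := congr1 (fun m => m%:R : R) tr; rewrite !natrD => E.
  have := congr1 (fun m => m%:R : R) ts; rewrite natrD => E2.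
  have -> : b%:R = t.+1%:R + 2 - a%:R - r%:R :> R by lra.
  by rewrite E2; ring.
have [kD|kD] := eqVneq k (t + 4)%N.
  rewrite kD -/X -/Y; split; first by rewrite -addrA; lra.
  move=> E; split=> //; have s00 : s%:R * (X - Y) = 0 by lra.
  move/eqP: s00; rewrite mulf_eq0 subr_eq0 (gt_eqF XY) orbF pnatr_eq0.
  by move/eqP => s00; lia.
have gk : g 1 k < g 1 (t + 4).
  by rewrite (esc_sym esc) ?(@esc_sym _ _ esc 1 (t + 4)%N) //; [apply: (esc_incr esc)| |]; lia.
have aX : a%:R * inc k 1 <= a%:R * X.
  case: a at1 kE {total s0 r0 ts tr} => [|a] at1 kE; first by rewrite !mul0r.
  by apply: ler_wpM2l => //; apply: inc_lel => //; lia.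
have bY : b%:R * inc k 2 <= b%:R * Y.
  case: b kE {total s0 r0 ts tr} => [|b] kE; first by rewrite !mul0r.
  by apply: ler_wpM2l => //; apply: inc_lel => //; lia.
suff lt : g 1 k + a%:R * inc k 1 + b%:R * inc k 2 <
    g 1 (t + 4) + t.+1%:R * X + 2 * Y.
  by split; [exact: ltW|move=> E; rewrite E ltxx in lt].
by clear kD tr ts; lra.
Qed.

Variables (T : finType) (e : rel T).
Hypotheses (e_sym : symmetric e) (e_irr : irreflexive e).
Variable d : nat.
Hypothesis d4 : (4 <= d)%N.
Implicit Types (S : {set T}) (u v x y w : T) (p : nat -> T).
Local Notation dg := (dg e).
Local Notation nb := (nb e).
Local Notation weight := (weight g e).

(** * The extremal value *)

(** The index of the extremal graph on d + 2 + t vertices. For t = 0, the pendant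
    vertex v_1 hangs on a vertex of degree 3, and so does v_(d+1) if d = 4, whence
    the factor of beta 3; each later step adds a pendant vertex to v_2. *)
Fixpoint extremal t : R :=
  if t is t'.+1 then
    extremal t' + (g 1 (t' + 4) + t%:R * inc (t' + 4) 1 + 2 * inc (t' + 4) 2)
  else (d + 2)%:R * g 2 2 + 2 * (alpha 1 + 3 * alpha 3)
       + (if d == 4%N then 2 else 1) * beta 3.

Lemma extremal_step t : extremal t + g 2 2 < extremal t.+1.
Proof.
have g22 : g 2 2 < g 1 (t + 4).
  rewrite (esc_sym esc) //; last by lia.
  apply: lt_trans (esc_shift esc) _; apply: (esc_incr esc); lia.
have i1 : 0 < inc (t + 4) 1 by apply: inc_gt0 => //; lia.
have i2 : 0 < inc (t + 4) 2 by apply: inc_gt0 => //; lia.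
have : 0 <= t.+1%:R * inc (t + 4) 1 by rewrite mulr_ge0 // ltW.
by rewrite /=; lra.
Qed.

(** The bound of [weight_deg_le4] for a graph with N pendant vertices stays
    below the extremal value as soon as one pendant vertex has been added; more
    vertices only widen the gap, by [extremal_step]. *)
Lemma extremal_large t N mu : (N <= 2)%N ->
  mu = 3 * alpha 3 \/ mu = 2 * alpha 4 ->
  (d + 2 + t.+1)%:R * g 2 2 + N%:R * (alpha 1 + mu + beta 4) < extremal t.+1.
Proof.
move=> N2 muE.
have a1 := alpha1_lt esc; have a4 := alpha3_lt4 esc; have a3 := alpha3_gt0 esc.
have b3 := @beta_gt0 _ _ esc 3 isT; have b4 := @beta_gt0 _ _ esc 4 isT.
elim: t => [|t IHt]; last first.
  apply: lt_trans (extremal_step t.+1).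
  rewrite addnS -natr1; lra.
rewrite /extremal add0n (natrD _ (d + 2)).
have -> : g 1 4 + 1 * inc 4 1 + 2 * inc 4 2 =
    g 2 2 + alpha 1 + 4 * alpha 4 + 2 * beta 4 - 3 * alpha 3 - beta 3.
  rewrite /inc /beta /corr /alpha /=.
  rewrite (@esc_sym _ _ esc 4 1) // (@esc_sym _ _ esc 4 2) // (@esc_sym _ _ esc 3 1) //.
  by rewrite (@esc_sym _ _ esc 3 2) // (@esc_sym _ _ esc 2 1) //; ring.
have c0 : beta 3 <= (if d == 4%N then 2 else 1) * beta 3.
  by case: ifP => _; lra.
move: N N2 => [|[|[|N]]] // _.
- by rewrite mul0r; lra.
- by case: muE => ->; lra.
- by case: muE => ->; lra.
Qed.

(** * A path with one ear *)

(** The path p with one further vertex w joined to p i and p j: the graphs on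
    d + 2 vertices that are to be compared. *)
Record ear p S w (i j : nat) : Prop := Ear {
  ear_geo : geodesic e p d;
  ear_set : S = w |: trace p d;
  ear_off : w \notin trace p d;
  ear_adj : forall k, (k <= d)%N -> e w (p k) = (k == i) || (k == j);
  ear_lt : (i < j)%N;
  ear_gap : (j <= i.+2)%N;
  ear_end : (j <= d)%N }.

Lemma trace_rev p : trace (fun i => p (d - i)%N) d = trace p d.
Proof.
apply/setP => u; apply/traceP/traceP => -[i li ->].
  by exists (d - i)%N => //; exact: leq_subr.
by exists (d - i)%N; rewrite ?leq_subr // subKn.
Qed.

(** Reading the path backwards exchanges the two ends of the ear. *)
Lemma ear_rev p S w i j : ear p S w i j ->
  ear (fun k => p (d - k)%N) S w (d - j)%N (d - i)%N.
Proof.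
case=> geo sS off adj lt gap jd; split; rewrite ?trace_rev //; try lia.
  exact: geodesic_rev.
by move=> k kd; rewrite adj ?leq_subr //; lia.
Qed.

Section Ear.
Variables (p : nat -> T) (S : {set T}) (w : T) (i j : nat).
Hypothesis er : ear p S w i j.

Lemma ear_sum (F : T -> R) :
  \sum_(u in S) F u = F w + \sum_(k < d.+1) F (p k).
Proof.
by rewrite (ear_set er) big_setU1 ?(ear_off er) //= (big_trace (ear_geo er)).
Qed.

Lemma ear_card : #|S| = (d + 2)%N.
Proof.
rewrite (ear_set er) cardsU1 (ear_off er) (card_trace (ear_geo er)); lia.
Qed.

Lemma ear_sub : trace p d \subset S.
Proof. by rewrite (ear_set er) subsetUr. Qed.

Lemma ear_setD : S :\: trace p d = [set w].
Proof.
rewrite (ear_set er) setDUl setDv setU0; apply/setDidPl.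
by rewrite disjoints1 (ear_off er).
Qed.

Lemma ear_dg_path k : (k <= d)%N ->
  dg S (p k) = ((0 < k) + (k < d) + ((k == i) || (k == j)))%N.
Proof.
move=> kd; rewrite (dg_setID _ _ ear_sub).
rewrite (dg_trace e_sym e_irr (ear_geo er)) //; congr (_ + _)%N.
by rewrite ear_setD dg_set1 e_sym (ear_adj er).
Qed.

Lemma ear_dg_top : dg S w = 2%N.
Proof.
case: er => geo sS off adj lt gap jd.
have -> : dg S w = #|[set p i; p j]|; last first.
  by rewrite cards2 (geodesic_eq geo) //; lia.
rewrite dg_card; apply: eq_card => u; rewrite !inE sS !inE.
apply/andP/idP.
  case=> /orP[/eqP->|/traceP[k kd ->]]; first by rewrite e_irr.
  by rewrite adj // !(geodesic_eq geo) //; lia.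
case/orP => /eqP->; rewrite adj ?eqxx ?orbT //; try lia.
  by rewrite mem_trace ?orbT //; lia.
by rewrite mem_trace ?orbT //.
Qed.

Lemma ear_cases u : u \in S ->
  u = w \/ exists2 k, (k <= d)%N & u = p k.
Proof.
by rewrite (ear_set er) !inE => /orP[/eqP|/traceP]; [left|right].
Qed.

(** The pendant vertices are the ends of the path that the ear does not touch. *)
Lemma ear_sum_pendant (F : T -> R) :
  \sum_(u in S | dg S u == 1%N) F u =
  (if (0 < i)%N then F (p 0) else 0) + (if (j < d)%N then F (p d) else 0).
Proof.
have lt := ear_lt er; have jd := ear_end er.
rewrite big_mkcondr ear_sum ear_dg_top /= add0r.
rewrite big_ord_recl; case: d d4 jd ear_dg_path => // m m4 jd dgp.
rewrite big_ord_recr /= !dgp //= big1 => [|k _]; last first.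
  have km := ltn_ord k; rewrite ifF // dgp /bump /=; last by lia.
  by apply/eqP; lia.
rewrite add0r; congr (_ + _); congr (if _ then _ else _).
  by lia.
by rewrite /bump /= add1n; lia.
Qed.

Lemma ear_nb_end k l (F : T -> R) : (k <= d)%N -> (l <= d)%N -> e (p k) (p l) ->
  dg S (p k) = 1%N -> \sum_(v in S | e (p k) v) F v = F (p l).
Proof.
move=> kd ld ekl /dg1_nb[y nbk].
have : p l \in nb S (p k) by rewrite inE (ear_set er) !inE mem_trace // orbT.
rewrite nbk => /set1P ply; rewrite (big_pred1 y) ?ply // => v.
by have := in_set1 v y; rewrite -nbk inE.
Qed.

Lemma ear_weight :
  weight S = 2 * ((d + 2)%:R * g 2 2 + ((0 < i) + (j < d))%N%:R * (alpha 1 + 3 * alpha 3)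
    + ((if (0 < i)%N then beta (dg S (p 1)) else 0) +
       (if (j < d)%N then beta (dg S (p d.-1)) else 0)))
   + \sum_(u in S) \sum_(v in S | e u v)
        (if (dg S u == 3%N) && (dg S v == 3%N) then corr 3 3 else 0).
Proof.
have lt := ear_lt er; have jd := ear_end er; have geo := ear_geo er.
rewrite (weight_deg_le3 esc e_sym) //.
- rewrite ear_card; congr (2 * (_ + _ + _) + _).
    congr (_ * _); rewrite -sum1dep_card natr_sum /=.
    by rewrite ear_sum_pendant natrD; do 2!case: (_ < _)%N.
  rewrite ear_sum_pendant; congr (_ + _).
    case: ifP => // i0; apply: ear_nb_end => //; first by lia.
      by rewrite (geodesic_adj e_sym e_irr geo) //; lia.
    by rewrite ear_dg_path //; lia.
  case: ifP => // jd'; apply: ear_nb_end => //; first by lia.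
    by rewrite (geodesic_adj e_sym e_irr geo) //; lia.
  by rewrite ear_dg_path //; lia.
- move=> u /ear_cases[->|[k kd ->]]; first by rewrite ear_dg_top.
  by rewrite ear_dg_path //; lia.
- move=> u v /ear_cases[->|[k kd ->]]; first by rewrite ear_dg_top.
  move=> /ear_cases[->|[l ld ->]]; first by rewrite ear_dg_top.
  by rewrite (geodesic_adj e_sym e_irr geo) // !ear_dg_path //; lia.
- rewrite (degree_sum_setID e_sym ear_sub) (degree_sum_trace e_sym e_irr geo) ear_card.
  rewrite ear_setD big_set1 ear_dg_top.
  have : dg S w = dg (trace p d) w.
    by rewrite (dg_setID _ _ ear_sub) ear_setD dg_set1 e_irr addn0.
  by rewrite ear_dg_top => <-; lia.
Qed.

End Ear.

(** * The extremal graphs *)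

(** The induced subgraph on S is the extremal graph: p i is its v_(i+1), the
    vertex w is the one joined to v_2 and v_4, and the other vertices off p are
    pendant at v_2. *)
Record und_shape p S w : Prop := Shape {
  shape_geo : geodesic e p d;
  shape_sub : trace p d \subset S;
  shape_mem : w \in S;
  shape_off : w \notin trace p d;
  shape_top : forall u, u \in S -> e w u = (u == p 1) || (u == p 3);
  shape_rest : forall q u, q \in S -> q \notin trace p d -> q != w -> u \in S ->
    e q u = (u == p 1) }.

Lemma ear_shape p S w : ear p S w 1 3 -> und_shape p S w.
Proof.
move=> er; have geo := ear_geo er; split=> //.
- exact: ear_sub er.
- by rewrite (ear_set er) !inE eqxx.
- exact: ear_off er.
- move=> u; rewrite (ear_set er) !inE => /orP[/eqP->|/traceP[k kd ->]].
    have off := ear_off er; rewrite e_irr; apply/esym/negbTE.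
    by rewrite negb_or !(contraNneq _ off) // => ->; apply: mem_trace; lia.
  by rewrite (ear_adj er) // !(geodesic_eq geo) //; lia.
- by move=> q u; rewrite (ear_set er) !inE => /orP[->|->].
Qed.

Lemma shape_ear p S w : und_shape p S w -> #|S| = (d + 2)%N -> ear p S w 1 3.
Proof.
case=> geo sub wS off top rest cardS; split=> //; try lia.
  apply/esym/eqP; rewrite eqEcard subUset sub1set wS sub /=.
  by rewrite cardsU1 off (card_trace geo) cardS; lia.
move=> k kd; rewrite top ?(subsetP sub) ?mem_trace //.
by rewrite !(geodesic_eq geo) //; lia.
Qed.

Lemma shape_rem p S w q : und_shape p S w -> q \in S -> q \notin trace p d -> q != w ->
  und_shape p (S :\ q) w.
Proof.
case=> geo sub wS off top rest qS qt qw; split=> //.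
- by rewrite subsetD1 sub.
- by rewrite !inE eq_sym qw.
- by move=> u /setD1P[_]; exact: top.
- by move=> r u /setD1P[_ rS] rt rw /setD1P[_]; exact: rest.
Qed.

Lemma shape_add p S w x : x \in S -> nb S x = [set p 1] -> und_shape p (S :\ x) w ->
  und_shape p S w.
Proof.
move=> xS nbx [geo sub wS off top rest].
have exE u : u \in S -> e x u = (u == p 1).
  by move=> uS; rewrite -(in_set1 u (p 1)) -nbx inE uS.
have xE u : u \in S -> (u == x) || (u \in S :\ x).
  by move=> uS; rewrite !inE uS andbT orbN.
have [xt xw] : x \notin trace p d /\ x != w.
  split; first by apply/negP => /(subsetP sub); rewrite !inE eqxx.
  by apply: contraTneq wS => <-; rewrite !inE eqxx.
have nx k : (k <= d)%N -> (x == p k) = false.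
  by move=> kd; apply: contraNF xt => /eqP->; apply: mem_trace.
have wS' : w \in S by case/setD1P: wS.
split=> //.
- exact: subset_trans sub (subD1set _ _).
- move=> u /xE/orP[/eqP->|]; last exact: top.
  rewrite !nx; [|lia|lia]; rewrite e_sym exE //; apply: contraNF off => /eqP->.
  by apply: mem_trace; lia.
- move=> q u /xE/orP[/eqP-> _ _|qS qt qw]; first exact: exE.
  move=> /xE/orP[/eqP->|]; last exact: rest.
  rewrite nx; last by lia.
  rewrite e_sym exE; last by case/setD1P: qS.
  by apply: contraNF qt => /eqP->; apply: mem_trace; lia.
Qed.

Section ShapeDegrees.
Variables (p : nat -> T) (S : {set T}) (w : T).
Hypothesis sh : und_shape p S w.

Let geo := shape_geo sh.

Lemma shape_card_rest : (#|S :\: trace p d| + d.+1 = #|S|)%N.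
Proof. by rewrite -(cardsID (trace p d) S) (setIidPr (shape_sub sh)) (card_trace geo) addnC. Qed.

Lemma shape_dg_path k : (k <= d)%N ->
  dg S (p k) = ((0 < k) + (k < d) + (k == 3) +
                (k == 1) * #|S :\: trace p d|)%N.
Proof.
move=> kd; rewrite (dg_setID _ _ (shape_sub sh)) (dg_trace e_sym e_irr geo) //.
rewrite -[RHS]addnA; congr (_ + _)%N; rewrite dgE.
have pkS : p k \in S by rewrite (subsetP (shape_sub sh)) ?mem_trace.
rewrite (eq_bigr (fun v => (k == 1) + (if v == w then (k == 3 : nat) else 0)))%N.
  rewrite big_split /= sum_nat_const addnC mulnC; congr (_ + _)%N.
  rewrite -big_mkcondr /= (big_pred1 w) // => v; rewrite /= inE.
  by case: eqP => [->|]; rewrite ?andbF // (shape_off sh) (shape_mem sh).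
move=> v /setDP[vS vt]; rewrite e_sym; have [->|vw] := eqVneq v w.
  by rewrite (shape_top sh) // !(geodesic_eq geo) //; lia.
by rewrite (shape_rest sh) // (geodesic_eq geo) //; lia.
Qed.

Lemma shape_dg_top : dg S w = 2%N.
Proof.
have -> : dg S w = #|[set p 1; p 3]|; last first.
  by rewrite cards2 (geodesic_eq geo) //; lia.
rewrite dg_card; apply: eq_card => u; rewrite !inE.
have mS k : (k <= d)%N -> p k \in S by move=> kd; rewrite (subsetP (shape_sub sh)) ?mem_trace.
apply/andP/idP => [[uS]|]; first by rewrite (shape_top sh).
by case/orP => /eqP->; rewrite (shape_top sh) ?eqxx ?orbT ?mS //; lia.
Qed.

Lemma shape_nb_rest q : q \in S -> q \notin trace p d -> q != w ->
  nb S q = [set p 1].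
Proof.
move=> qS qt qw; apply/setP => u; rewrite !inE; apply/andP/idP => [[uS]|/eqP->].
  by rewrite (shape_rest sh).
have p1 : p 1 \in S by rewrite (subsetP (shape_sub sh)) ?mem_trace //; lia.
by rewrite (shape_rest sh) ?eqxx.
Qed.

Lemma shape_cases u : u \in S ->
  [\/ exists2 k, (k <= d)%N & u = p k, u = w | u \notin trace p d /\ u != w].
Proof.
move=> uS; have [/traceP ut|ut] := boolP (u \in trace p d); first by constructor 1.
by have [->|] := eqVneq u w; [constructor 2|constructor 3].
Qed.

Lemma shape_big_dg u : u \in S -> (2 < dg S u)%N -> u = p 1 \/ u = p 3.
Proof.
move=> uS; case: (shape_cases uS) => [[k kd ->]|->|[ut uw]].
- rewrite shape_dg_path //; have [->|k1] := eqVneq k 1%N; first by left.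
  by have [->|k3] := eqVneq k 3%N; [right|lia].
- by rewrite shape_dg_top.
- by rewrite dg_card (shape_nb_rest uS) // cards1.
Qed.

(** A pendant neighbour of v_4 can only be v_5, as the end of the path. *)
Lemma shape_pendant_top z : z \in S -> e (p 3) z -> (dg S z <= 1)%N -> d = 4%N.
Proof.
move=> zS e3z; case: (shape_cases zS) => [[k kd zE]|->|[zt zw]].
- have : (k == 4%N) || (3%N == k.+1).
    by move: e3z; rewrite zE (geodesic_adj e_sym e_irr geo) // ltnW.
  by case/orP => /eqP kE; rewrite zE shape_dg_path //; lia.
- by rewrite shape_dg_top.
- by move: e3z; rewrite e_sym (shape_rest sh zS zt zw) ?(geodesic_eq geo) //;
    rewrite ?(subsetP (shape_sub sh)) ?mem_trace //; lia.
Qed.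

End ShapeDegrees.

(** Removing a pendant vertex off the path gives the recursion that defines
    [extremal]; the graph on d + 2 vertices is a path with an ear. *)
Lemma shape_weight p S w t : und_shape p S w -> #|S| = (d + 2 + t)%N ->
  weight S = 2 * extremal t.
Proof.
elim: t S => [|t IHt] S sh cardS.
  have er : ear p S w 1 3 by apply: shape_ear; rewrite // cardS addn0.
  have geo := ear_geo er.
  rewrite (ear_weight er) [X in _ + X]big1 => [|u uS]; last first.
    rewrite big1 // => v /andP[vS euv]; rewrite ifF //; apply: contraTF euv.
    case/andP => /eqP u3 /eqP v3.
    have [] // := shape_big_dg sh uS; rewrite ?u3 // => ->;
    have [] // := shape_big_dg sh vS; rewrite ?v3 // => ->;
    by rewrite (geodesic_adj e_sym e_irr geo); lia.
  rewrite addr0 d4 (_ : (0 < 1) + true = 2)%N //=.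
  rewrite !(ear_dg_path er) //; try lia.
  have -> : ((0 < 1) + (1 < d) + ((1 == 1) || (1 == 3)))%N = 3%N by lia.
  have [d_4|d_4] := eqVneq d 4%N.
    have -> : ((0 < d.-1) + (d.-1 < d) + ((d.-1 == 1) || (d.-1 == 3)))%N = 3%N by lia.
    by ring.
  have -> : ((0 < d.-1) + (d.-1 < d) + ((d.-1 == 1) || (d.-1 == 3)))%N = 2%N by lia.
  by rewrite (beta2 esc); ring.
have geo := shape_geo sh.
have cr := shape_card_rest sh.
have [q qP] : exists q, q \in (S :\: trace p d) :\ w.
  apply/set0Pn; rewrite -card_gt0; have := cardsD1 w (S :\: trace p d).
  by rewrite inE (shape_mem sh) (shape_off sh) /=; lia.
case/setD1P: qP => qw /setDP[qS qt].
have sh' := shape_rem sh qS qt qw; have nbq := shape_nb_rest sh qS qt qw.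
have cardS' : #|S :\ q| = (d + 2 + t)%N.
  by have := cardsD1 q S; rewrite qS cardS; lia.
rewrite (weight_rem esc e_sym e_irr qS nbq) (IHt _ sh') // -mulrDr /=; congr (2 * (_ + _)).
have d1 : dg S (p 1) = (t + 4)%N by rewrite (shape_dg_path sh) //; lia.
rewrite d1 -addrA; congr (_ + _).
have mS k : (k <= d)%N -> p k \in S by move=> kd; rewrite (subsetP (shape_sub sh)) ?mem_trace.
have nt k : (k <= d)%N -> p k \in trace p d by move=> kd; rewrite mem_trace.
have p2w : p 2 != w by apply: contraNneq (shape_off sh) => <-; apply: nt; lia.
set A := nb (S :\ q) (p 1).
have sub2 : [set p 2; w] \subset A.
  apply/subsetP => z; rewrite !inE => /orP[] /eqP->.
    rewrite mS ?(geodesic_adj e_sym e_irr geo) /= ?andbT //; try lia.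
    by apply: contraNneq qt => <-; apply: nt; lia.
  rewrite e_sym (shape_top sh) ?mS ?(shape_mem sh) ?eqxx ?andbT /= 1?eq_sym //; lia.
have cardA : #|A| = (t + 3)%N.
  rewrite -dg_card (shape_dg_path sh') //; last by lia.
  by have := shape_card_rest sh'; lia.
rewrite (big_setID [set p 2; w]) /= (setIidPr sub2) addrC; congr (_ + _).
  rewrite (eq_bigr (fun=> inc (t + 4) 1)) => [|z]; last first.
    rewrite !inE negb_or => /andP[/andP[z2 zw] /andP[/andP[zq zS] e1z]].
    case: (shape_cases p w zS) e1z z2 zw => [[k kd ->]|->|[ut uw]].
    - rewrite (geodesic_adj e_sym e_irr geo) ?(geodesic_eq geo) //; [|lia|lia] => k1 k2 _.
      by rewrite (shape_dg_path sh) //; congr inc; lia.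
    - by rewrite eqxx.
    - by rewrite dg_card (shape_nb_rest sh zS) // cards1.
  rewrite sumr_const -[LHS]mulr_natl; congr (_%:R * _).
  by have := cardsID [set p 2; w] A; rewrite (setIidPr sub2) cards2 p2w; lia.
rewrite (eq_bigr (fun=> inc (t + 4) 2)) => [|z]; last first.
  rewrite !inE => /orP[/eqP->|/eqP->]; last by rewrite (shape_dg_top sh).
  by rewrite (shape_dg_path sh) //; [congr inc|]; lia.
by rewrite sumr_const -[LHS]mulr_natl cards2 p2w.
Qed.

End Bound.

(** * The upper bound *)

Section Main.
Set Implicit Arguments.
Unset Strict Implicit.
Variables (R : realFieldType) (g : nat -> nat -> R) (esc : escalating g).
Variables (T : finType) (e : rel T).
Hypotheses (e_sym : symmetric e) (e_irr : irreflexive e).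
Variables (d : nat) (p : nat -> T).
Hypotheses (d4 : (4 <= d)%N) (geo : geodesic e p d).
Implicit Types (S : {set T}) (u v x y w : T).
Local Notation dg := (dg e).
Local Notation nb := (nb e).
Local Notation weight := (weight g e).
Local Notation P := (trace p d).

(** Connected with as many edges as vertices, hence unicyclic, and large enough
    to contain the diametral path. *)
Record unicyclic_part S : Prop := UnicyclicPart {
  part_sub : P \subset S;
  part_cut : cut_connected e S;
  part_sum : degree_sum e S = (#|S|.*2)%N }.

Lemma part_card S : unicyclic_part S -> (#|S :\: P| + d.+1 = #|S|)%N.
Proof.
move=> gS; rewrite -(cardsID P S) (setIidPr (part_sub gS)) (card_trace geo).
by rewrite addnC.
Qed.

Lemma part_rem S x y : unicyclic_part S -> x \in S -> x \notin P -> nb S x = [set y] ->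
  unicyclic_part (S :\ x).
Proof.
move=> [sub cut sum] xS xP nbx; split.
- by rewrite subsetD1 sub.
- exact: cut_connected_rem nbx cut.
- have := degree_sum_rem e_sym e_irr xS; rewrite sum dg_card nbx cards1.
  by have := cardsD1 x S; rewrite xS; lia.
Qed.

(** If all the vertices off P were pendant, each of them would bring at most
    one edge, and P itself has one edge less than vertices: one edge would be
    missing. *)
Lemma part_off S : unicyclic_part S -> exists w, [/\ w \in S, w \notin P & (1 < dg S w)%N].
Proof.
move=> gS; have cS := part_card gS.
have [/existsP[w /and3P[wS wP w1]]|/existsPn no] :=
  boolP [exists w, [&& w \in S, w \notin P & (1 < dg S w)%N]]; first by exists w.
have := part_sum gS.
rewrite (degree_sum_setID e_sym (part_sub gS)) (degree_sum_trace e_sym e_irr geo).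
have : (\sum_(u in S :\: P) (dg P u + dg S u) <= \sum_(u in S :\: P) 2)%N.
  apply: leq_sum => u /setDP[uS uP]; have := no u; rewrite uS uP /= -leqNgt.
  by have := dgS e u (part_sub gS); lia.
by rewrite sum_nat_const; lia.
Qed.

Lemma part_dg_gt0 S u : unicyclic_part S -> u \in S -> (0 < dg S u)%N.
Proof.
by move=> gS uS; apply: (dg_gt0 (part_cut gS)); have := part_card gS; lia.
Qed.

Lemma part_inner S k : unicyclic_part S -> (0 < k < d)%N -> (1 < dg S (p k))%N.
Proof.
move=> gS kd; apply: leq_trans (dgS e (p k) (part_sub gS)).
by rewrite (dg_trace e_sym e_irr geo); lia.
Qed.

(** The vertices of S that are not pendant neighbours of y include a vertex off
    P of degree at least 2, the inner vertices of P, and one end of P: its two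
    ends are too far apart to have a common neighbour. *)
Lemma part_pendants S y : unicyclic_part S ->
  (#|[set z in nb S y | dg S z == 1%N]| + d.+1 <= #|S|)%N.
Proof.
move=> gS; have [w [wS wP w1]] := part_off gS.
set L := [set z in _ | _].
(* The end p k0 is the one left out: the other end is not adjacent to y. *)
pose k0 := if e y (p 0) then 0%N else d.
have k0d : (k0 <= d)%N by rewrite /k0; case: ifP.
pose B := w |: (P :\ p k0).
have cB : #|B| = d.+1.
  rewrite cardsU1 !inE (negPf wP) andbF /=.
  by have := cardsD1 (p k0) P; rewrite (card_trace geo) mem_trace //; lia.
have BS : B \subset S.
  by rewrite subUset sub1set wS (subset_trans (subD1set _ _) (part_sub gS)).
have LS : L \subset S :\: B.
  apply/subsetP => z; rewrite !inE => /andP[/andP[zS eyz] /eqP z1].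
  rewrite zS andbT negb_or negb_and negbK.
  have -> : z != w by apply: contraTneq w1 => <-; rewrite z1.
  have [/traceP[k kd zE]|] := boolP (z \in P); last by rewrite orbT.
  rewrite orbF zE (geodesic_eq geo) // /k0.
  have : (k == 0%N) || (k == d).
    have [kk|] := boolP (0 < k < d)%N; last by lia.
    by have := part_inner gS kk; rewrite -zE z1.
  case: ifP => [ey0 /orP[//|/eqP kd']|ey0 /orP[/eqP k0'|//]].
    case: geo => _ _ _ sc2; have := sc2 y 0%N d isT (leqnn d) ey0.
    by rewrite -kd' -zE => /(_ eyz); lia.
  by move: ey0; rewrite -k0' -zE eyz.
have := subset_leq_card LS; rewrite -cB; have := cardsID B S.
by rewrite (setIidPr BS); lia.
Qed.

(** Among the d + 1 vertices of P at most three are neighbours of y, and at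
    most two if y itself is on P. *)
Lemma part_dg_le S y : unicyclic_part S -> y \in S -> (dg S y + d <= #|S|.+1)%N.
Proof.
move=> gS yS; have cS := part_card gS.
rewrite (dg_setID e y (part_sub gS)).
have sub : nb (S :\: P) y \subset S :\: P.
  by apply/subsetP => z; rewrite inE => /andP[].
have [/traceP[k kd yE]|yP] := boolP (y \in P).
  have := subset_leq_card sub; rewrite -dg_card.
  by rewrite {2}yE (dg_trace e_sym e_irr geo) //; lia.
have := dg_trace_le3 geo y.
have : nb (S :\: P) y \subset (S :\: P) :\ y.
  by rewrite subsetD1 sub inE e_irr andbF.
move/subset_leq_card; rewrite -dg_card.
by have := cardsD1 y (S :\: P); rewrite inE yS yP; lia.
Qed.

(** When all pendant vertices lie on P they are among its two ends. *)
Section NoPendantOff.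
Variable S : {set T}.
Hypotheses (gS : unicyclic_part S)
  (no : forall x, x \in S -> x \notin P -> dg S x != 1%N).

Lemma core_pendant_end u : u \in S -> dg S u = 1%N -> u = p 0 \/ u = p d.
Proof.
move=> uS u1; have [/traceP[k kd uE]|/(no uS)] := boolP (u \in P); last by rewrite u1.
have : (k == 0%N) || (k == d).
  have [kk|] := boolP (0 < k < d)%N; last by lia.
  by have := part_inner gS kk; rewrite -uE u1.
by case/orP => /eqP kE; rewrite uE kE; [left|right].
Qed.

Lemma core_pendant_adj u v : u \in S -> v \in S -> e u v ->
  dg S u = 1%N -> dg S v != 1%N.
Proof.
move=> uS vS euv /(core_pendant_end uS) uE; apply/eqP => /(core_pendant_end vS) vE.
by case: uE vE euv => -> [] ->; rewrite (geodesic_adj e_sym e_irr geo); lia.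
Qed.

Let N1 := [set u in S | dg S u == 1%N].

Lemma core_pendants_le2 : (#|N1| <= 2)%N.
Proof.
have : N1 \subset [set p 0; p d].
  apply/subsetP => u; rewrite !inE => /andP[uS /eqP u1].
  by case: (core_pendant_end uS u1) => ->; rewrite eqxx ?orbT.
by move/subset_leq_card/leq_trans; apply; rewrite cards2; case: eqP.
Qed.

(** The sum of deg - 2 is 0 and its negative terms add up to -2 at worst. *)
Lemma core_dg_le4 u : u \in S -> (dg S u <= 4)%N.
Proof.
move=> uS; have := part_sum gS; rewrite /degree_sum (bigD1 u) //=.
have : (\sum_(v in S | v != u) 2 <=
    \sum_(v in S | v != u) dg S v + \sum_(v in S | v != u) (dg S v == 1%N))%N.
  rewrite -big_split /=; apply: leq_sum => v /andP[vS _].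
  by have := part_dg_gt0 gS vS; lia.
have : (\sum_(v in S | v != u) (dg S v == 1%N) <= #|N1|)%N.
  rewrite -sum1dep_card [in X in (_ <= X)%N]big_mkcondr /= [in X in (_ <= X)%N](bigD1 u) //=.
  apply: leq_trans (leq_addl _ _); apply: leq_sum => v _; by case: (_ == _).
have -> : (\sum_(v in S | v != u) 2 = (#|S| - 1).*2)%N.
  by have : (\sum_(v in S) 2 = #|S| * 2)%N; [rewrite sum_nat_const|rewrite (bigD1 u) //=; lia].
have := core_pendants_le2; lia.
Qed.

Lemma core_weight t : #|S| = (d + 2 + t.+1)%N -> weight S < 2 * extremal g d t.+1.
Proof.
move=> cardS.
have dS u : u \in S -> (0 < dg S u <= 4)%N.
  by move=> uS; rewrite part_dg_gt0 // core_dg_le4.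
have bnd mu : mu = 3 * alpha g 3 \/ mu = 2 * alpha g 4 ->
    3 * alpha g 3 <= mu -> 2 * alpha g 4 <= mu -> weight S < 2 * extremal g d t.+1.
  move=> muE mu3 mu4.
  apply: le_lt_trans (weight_deg_le4 esc e_sym mu3 mu4 dS core_pendant_adj (part_sum gS)) _.
  by rewrite ltr_pM2l // cardS; apply: extremal_large core_pendants_le2 muE.
have [le|/ltW le] := leP (3 * alpha g 3) (2 * alpha g 4).
  by apply: (bnd (2 * alpha g 4)) => //; right.
by apply: (bnd (3 * alpha g 3)) => //; left.
Qed.

End NoPendantOff.

(** The count of edges leaves two for the only vertex off P. *)
Lemma part_ear S : unicyclic_part S -> #|S| = (d + 2)%N ->
  exists w i j, ear e d p S w i j.
Proof.
move=> gS cardS; have cS := part_card gS.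
have /eqP/cards1P[w Dw] : #|S :\: P| = 1%N by lia.
have wSP : w \in S :\: P by rewrite Dw inE.
have /setDP[wS wP] := wSP.
have SE : S = w |: P.
  by rewrite -(setID S P) (setIidPr (part_sub gS)) Dw setUC.
have dw : dg P w = 2%N.
  have := part_sum gS; rewrite (degree_sum_setID e_sym (part_sub gS)).
  rewrite (degree_sum_trace e_sym e_irr geo) Dw big_set1.
  by rewrite (dg_setID e w (part_sub gS)) Dw dg_set1 e_irr; lia.
have /eqP/cards2P[a [b [ab nbw]]] : #|nb P w| = 2%N by [].
have aP : a \in nb P w by rewrite nbw !inE eqxx.
have bP : b \in nb P w by rewrite nbw !inE eqxx orbT.
have nbwE k : (k <= d)%N -> e w (p k) = (p k \in [set a; b]).
  by move=> kd; rewrite -nbw inE mem_trace.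
move: aP bP; rewrite !inE => /andP[/traceP[i id aE] ewa] /andP[/traceP[j jd bE] ewb].
have earI i' j' : (i' < j')%N -> (i' <= d)%N -> (j' <= d)%N -> e w (p i') -> e w (p j') ->
    (forall k, (k <= d)%N -> e w (p k) = (k == i') || (k == j')) ->
    ear e d p S w i' j'.
  move=> lt id' jd' ei ej adj; split=> //.
  by case: geo => _ _ _ sc2; exact: sc2 ei ej.
exists w; have [ij|ij|ij] := ltngtP i j.
- exists i, j; apply: earI; rewrite -?aE -?bE // => k kd.
  by rewrite nbwE // !inE aE bE !(geodesic_eq geo).
- exists j, i; apply: earI; rewrite -?aE -?bE // => k kd.
  by rewrite nbwE // !inE aE bE !(geodesic_eq geo) // orbC.
- by rewrite aE bE ij eqxx in ab.
Qed.

(** The extremal value needs both ends of the path pendant, the largest possible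
    number of pendant vertices with a neighbour of degree 3 (two if d = 4, one
    otherwise), and no edge between two vertices of degree 3, whose defect is
    negative. So the ear spans two edges and starts at the second vertex of the
    path, counted from one of its ends. *)
Lemma ear_weight_le p' S w i j : ear e d p' S w i j ->
  weight S <= 2 * extremal g d 0 /\
  (weight S = 2 * extremal g d 0 -> exists p'' w', und_shape e d p'' S w').
Proof.
move=> er; have geo' := ear_geo er.
have ij := ear_lt er; have gap := ear_gap er; have jd := ear_end er.
have a1 := alpha1_lt esc; have a3 := alpha3_gt0 esc; have c33 := corr33_lt0 esc.
have b3 := @beta_gt0 _ _ esc 3 isT; have b2 := beta2 esc.
rewrite (ear_weight esc e_sym e_irr d4 er).
set C := \sum_(u in S) _.
have C0 : C <= 0.
  apply: sumr_le0 => u _; apply: sumr_le0 => v _; case: ifP => _ //; exact: ltW.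
(* An ear over a single inner edge makes both ends of this edge of degree 3. *)
have Clt : j = i.+1 -> (0 < i)%N -> (j < d)%N -> C < 0.
  move=> ji i0 jd'.
  have mS k : (k <= d)%N -> p' k \in S.
    by move=> kd; rewrite (subsetP (ear_sub er)) ?mem_trace.
  rewrite /C (bigD1 (p' i)) ?mS //=; last by lia.
  rewrite (bigD1 (p' j)) /=; last first.
    by rewrite mS ?(geodesic_adj e_sym e_irr geo') //; lia.
  rewrite !(ear_dg_path e_sym e_irr er) //; try lia.
  rewrite ifT; last by lia.
  apply: ltr_wnDr; last apply: ltr_wnDr => //.
    apply: sumr_le0 => u _; apply: sumr_le0 => v _; case: ifP => _ //; exact: ltW.
  apply: sumr_le0 => v _; case: ifP => _ //; exact: ltW.
rewrite !(ear_dg_path e_sym e_irr er) //; try lia.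
rewrite /=.
have x1 : ((0 < 1) + (1 < d) + ((1 == i) || (1 == j)))%N =
   (if (1 == i) || (1 == j) then 3 else 2)%N by case: ifP; lia.
have xd : ((0 < d.-1) + (d.-1 < d) + ((d.-1 == i) || (d.-1 == j)))%N =
   (if (d.-1 == i) || (d.-1 == j) then 3 else 2)%N by case: ifP; lia.
rewrite {}x1 {}xd.
set X := (d + 2)%:R * _.
case: (posnP i) => [i0|i0].
  have -> : (j < d)%N by lia.
  have -> : ((d.-1 == i) || (d.-1 == j)) = false by lia.
  rewrite b2 add0n /=; case: ifP => _; split; try (move=> E; exfalso); lra.
have [jd'|jd'] := ltnP j d; last first.
  have -> : ((1 == i) || (1 == j))%N = false by lia.
  rewrite b2 addn0 /=; case: ifP => _; split; try (move=> E; exfalso); lra.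
rewrite (_ : 1 + 1 = 2)%N //.
have [i1|i1] := eqVneq 1%N i; have [j1|j1] := eqVneq d.-1 j.
- have [d_4|d_4] := eqVneq d 4%N; last by lia.
  rewrite /= orbT; split=> [|_]; first by lra.
  exists p', w; apply: ear_shape => //.
  by have := er; have -> : i = 1%N by []; have -> : j = 3%N by lia.
- have -> : (d.-1 == i) = false by lia.
  rewrite /= b2; have [ji|ji] := eqVneq j i.+1.
    have c0 := Clt ji i0 jd'; case: ifP => _; split; try (move=> E; exfalso); lra.
  split=> [|_]; first by case: ifP => _; lra.
  exists p', w; apply: ear_shape => //.
  by have := er; have -> : i = 1%N by []; have -> : j = 3%N by lia.
- have -> : (1 == j)%N = false by lia.
  rewrite /= orbT b2; have [ji|ji] := eqVneq j i.+1.
    have c0 := Clt ji i0 jd'; case: ifP => _; split; try (move=> E; exfalso); lra.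
  split=> [|_]; first by case: ifP => _; lra.
  exists (fun k => p' (d - k)%N), w; apply: ear_shape => //.
  have := ear_rev e_sym d4 er.
  have -> : (d - j = 1)%N by lia.
  by have -> : (d - i = 3)%N by lia.
- have -> : (1 == j)%N = false by lia.
  have -> : (d.-1 == i) = false by lia.
  rewrite /= b2; case: ifP => _; split; try (move=> E; exfalso); lra.
Qed.


(** When a pendant vertex x off P is removed, equality makes S minus x extremal
    and the neighbour y of x a vertex of degree at least 3 in S minus x, where
    only v_2 and v_4 have such degrees. *)
Lemma part_weight_le S t : unicyclic_part S -> #|S| = (d + 2 + t)%N ->
  weight S <= 2 * extremal g d t /\
  (weight S = 2 * extremal g d t -> exists p' w, und_shape e d p' S w).
Proof.
elim: t S => [|t IHt] S gS cardS.
  have [|w [i [j er]]] := part_ear gS; first by rewrite cardS addn0.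
  exact: ear_weight_le er.
have [/existsP[x /and3P[xS xP /eqP x1]]|/existsPn no] :=
  boolP [exists x, [&& x \in S, x \notin P & dg S x == 1%N]]; last first.
  have no' x : x \in S -> x \notin P -> dg S x != 1%N.
    by move=> xS xP; have := no x; rewrite xS xP.
  have lt := core_weight gS no' cardS.
  by split=> [|E]; [exact: ltW|rewrite E ltxx in lt].
have [y nbx] := dg1_nb x1.
have /andP[yS exy] : (y \in S) && e x y.
  by have : y \in nb S x; [rewrite nbx set11|rewrite inE].
have gS' := part_rem gS xS xP nbx.
have cardS' : #|S :\ x| = (d + 2 + t)%N.
  by have := cardsD1 x S; rewrite xS cardS; lia.
have [le eq_shape] := IHt _ gS' cardS'.
set A := nb (S :\ x) y.
pose A1 := [set z in A | dg S z == 1%N].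
have dyA : dg S y = #|A|.+1.
  by rewrite (dg_rem e y xS) e_sym exy addn1.
have a_le : (#|A1| <= t.+1)%N.
  have := part_pendants y gS; rewrite cardS.
  have -> : [set z in nb S y | dg S z == 1%N] = x |: A1.
    apply/setP => z; rewrite !inE; have [->|] := eqVneq z x => //=.
    by rewrite xS e_sym exy x1.
  by rewrite cardsU1 !inE eqxx /=; lia.
have k_le := part_dg_le gS yS.
have cA : (#|A1| + #|A :\: A1| = #|A|)%N.
  rewrite -(cardsID A1 A); congr (_ + _)%N.
  by apply: eq_card => z; rewrite !inE; case: (_ == 1%N); rewrite ?andbF ?andbT ?andbb.
have sumA : \sum_(z in A) inc g (dg S y) (dg S z) <=
    #|A1|%:R * inc g (dg S y) 1 + #|A :\: A1|%:R * inc g (dg S y) 2.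
  have AA1 : A :&: A1 = A1.
    by apply/setP => z; rewrite !inE; case: (_ == 1%N); rewrite ?andbF ?andbT ?andbb.
  rewrite (big_setID A1) /= AA1; apply: lerD.
    rewrite (eq_bigr (fun=> inc g (dg S y) 1)) => [|z]; last first.
      by rewrite inE => /andP[_ /eqP->].
    by rewrite sumr_const [leRHS]mulr_natl.
  rewrite [leRHS]mulr_natl -sumr_const; apply: ler_sum => z zA.
  have zin : z \in A by case/setDP: zA.
  have zS : z \in S by move: zin; rewrite !inE -andbA => /and3P[].
  have z1 : dg S z != 1%N by move: zA; rewrite !inE; case: (dg S z == 1%N); rewrite ?andbF ?andbT ?andNb.
  have zk : (0 < #|A|)%N by rewrite card_gt0; apply/set0Pn; exists z.
  apply: inc_ler => //; first by rewrite dyA; lia.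
  by have := part_dg_gt0 gS zS; lia.
have [gain gain_eq] := @pendant_gain _ _ esc (dg S y) #|A1| #|A :\: A1| t
  ltac:(lia) a_le ltac:(lia).
rewrite (weight_rem esc e_sym e_irr xS nbx) -/A /=.
split=> [|E]; first by lra.
have [p' [w sh]] : exists p' w, und_shape e d p' (S :\ x) w by apply: eq_shape; lra.
have [dyE a_eq] : dg S y = (t + 4)%N /\ #|A1| = t.+1 by apply: gain_eq; lra.
clear gain gain_eq E sumA le eq_shape IHt.
have yx : y != x by apply: contraTneq exy => ->; rewrite e_irr.
have yS' : y \in S :\ x by rewrite !inE yx.
have dy' : dg (S :\ x) y = (t + 3)%N by rewrite dg_card -/A; lia.
have [|yE|yE] := shape_big_dg e_sym e_irr d4 sh yS'; first by rewrite dy'; lia.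
  exists p', w; apply: shape_add xS _ sh => //.
  by rewrite nbx yE.
(* Here x hangs on p' 3, and equality gives p' 3 another pendant neighbour z,
   which can only be the end of a path of length 4: reversing the path
   exchanges p' 1 and p' 3. *)
have geo' := shape_geo sh.
have t0 : t = 0%N.
  by move: dy'; rewrite yE (shape_dg_path e_sym e_irr d4 sh); lia.
have [z] : exists z, z \in A1 by apply/set0Pn; rewrite -card_gt0; lia.
rewrite !inE => /andP[/andP[/andP[zx zS] eyz] /eqP z1].
have zS' : z \in S :\ x by rewrite !inE zx.
have d_4 : d = 4%N.
  apply: (shape_pendant_top e_sym e_irr d4 sh zS'); first by rewrite -yE.
  by rewrite -z1 dgS // subD1set.
have er := shape_ear d4 sh (etrans cardS' (etrans (congr1 _ t0) (addn0 _))).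
have er' := ear_rev e_sym d4 er.
have [d1 d3] : (d - 3 = 1)%N /\ (d - 1 = 3)%N by rewrite d_4.
rewrite d1 d3 in er'.
exists (fun k => p' (d - k)%N), w; apply: shape_add xS _ _ => //.
  by rewrite nbx yE d_4.
exact: ear_shape er'.
Qed.

End Main.

(** * Counting the edges of a unicyclic graph *)

Section Cycles.
Set Implicit Arguments.
Unset Strict Implicit.
Local Open Scope nat_scope.
Variables (T : finType) (e : rel T).
Hypotheses (e_sym : symmetric e) (e_irr : irreflexive e).
Implicit Types (S A : {set T}) (u v x y z : T) (c s : seq T).

(** A path that cannot be prolonged at its head x has all neighbours of x on
    it; as there are at least two of them, one is not the successor of x and
    closes a cycle. *)
Lemma min_degree2_cycle S : S != set0 -> (forall u, u \in S -> 1 < dg e S u) ->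
  exists2 c, ucycle e c & 2 < size c.
Proof.
case/set0Pn => x0 x0S deg2.
suff grow m x s : #|T| - size s < m -> x \in S -> path e x s -> uniq (x :: s) ->
    exists2 c, ucycle e c & 2 < size c.
  by apply: (grow #|T|.+1 x0 [::]) => //; rewrite ltnS leq_subr.
elim: m x s => // m IHm x s lt xS pth uq.
have [/existsP[y /andP[ynb ys]]|/existsPn on] :=
  boolP [exists y, (y \in nb e S x) && (y \notin x :: s)].
  have uq' : uniq (y :: x :: s) by rewrite cons_uniq ys.
  have /= sz : size (y :: x :: s) <= #|T| by rewrite -(card_uniqP uq') max_card.
  move: ynb; rewrite inE => /andP[yS exy].
  apply: (IHm y (x :: s)) => //; last by rewrite /= e_sym exy.
  by rewrite /= subnS prednK; [rewrite -ltnS|rewrite subn_gt0 ltnW].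
have [y [z [ynb znb yz]]] : exists y z, [/\ y \in nb e S x, z \in nb e S x & y != z].
  by have /card_gt1P[y [z [? ? ?]]] := deg2 x xS; exists y, z.
have in_s v : v \in nb e S x -> e x v /\ v \in s.
  move=> vnb; have := on v; rewrite vnb negbK /= inE.
  by move: vnb; rewrite inE => /andP[_ exv]; case: eqP exv => [->|_ ->//]; rewrite e_irr.
have [y0 [s0 sE]] : exists y0 s0, s = y0 :: s0.
  by case: (s) (in_s y ynb) => [[]//|y0 s0 _]; exists y0, s0.
have [v [exv vs vy0]] : exists v, [/\ e x v, v \in s & v != y0].
  have [exy ys] := in_s y ynb; have [exz zs] := in_s z znb.
  have [yy0|] := eqVneq y y0; last by exists y.
  by exists z; split=> //; rewrite -yy0 eq_sym.
move: vs pth uq; rewrite sE inE (negPf vy0) /= => /splitPr[s1 s2].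
case/andP => exy0; rewrite cat_path /= => /andP[pth1 /andP[ev _]] uq.
exists (x :: y0 :: rcons s1 v); last by rewrite /= size_rcons.
apply/andP; split.
  by rewrite /= exy0 !rcons_path pth1 ev last_rcons e_sym exv.
move: uq; rewrite -cat_rcons -!cat_cons.
rewrite -[x :: _ :: _]/([:: x; y0] ++ rcons s1 v).
rewrite (_ : [&& _, _ & _] = uniq ([:: x; y0] ++ (rcons s1 v ++ s2))) //.
by rewrite catA cat_uniq => /and3P[].
Qed.

(** A set of vertices without cycle has a vertex of degree at most 1; removing
    it loses at most one edge. *)
Lemma acyclic_degree_sum S : (forall c, ucycle e c -> size c <= 2) -> S != set0 ->
  degree_sum e S + 2 <= #|S|.*2.
Proof.
move=> acyc; have [m cS] : exists m, #|S| <= m by exists #|S|.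
elim: m S cS => [|m IHm] S cS S0.
  by move: S0; rewrite -card_gt0; lia.
have [/existsP[x /andP[xS x1]]|/existsPn no] :=
  boolP [exists x, (x \in S) && (dg e S x <= 1)]; last first.
  have [|c uc] := min_degree2_cycle S0; last by rewrite ltnNge acyc.
  by move=> u uS; have := no u; rewrite uS /= -ltnNge.
have cx := cardsD1 x S; rewrite xS in cx.
rewrite (degree_sum_rem e_sym e_irr xS).
have [Sx0|Sx0] := eqVneq (S :\ x) set0.
  rewrite Sx0 /degree_sum big_set0 (dg_rem e x xS) Sx0 e_irr.
  have -> : dg e set0 x = 0 by rewrite dgE big_set0.
  by rewrite -muln2; lia.
by have := IHm _ _ Sx0; lia.
Qed.

(** Each vertex added across a cut brings at least one edge. *)
Lemma degree_sum_grow A : cut_connected e [set: T] -> A != set0 ->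
  #|A|.*2 <= degree_sum e A -> #|T|.*2 <= degree_sum e [set: T].
Proof.
move=> cut; have [m cA] : exists m, #|T| - #|A| <= m by exists (#|T| - #|A|).
elim: m A cA => [|m IHm] A cA A0 le; have [AT|AT] := eqVneq A setT;
  try by rewrite -cardsT -AT.
  have := subset_leq_card (subsetT A); rewrite cardsT => le'.
  have : A == setT by rewrite eqEcard subsetT cardsT; lia.
  by rewrite (negPf AT).
have [u [v [uA _ vA euv]]] := cut A (subsetT _) A0 AT.
have AE : (v |: A) :\ v = A by rewrite setU1K.
apply: (IHm (v |: A)).
- rewrite cardsU1 vA; have := max_card (mem (v |: A)); rewrite cardsU1 vA; lia.
- by apply/set0Pn; exists v; rewrite !inE eqxx.
rewrite (degree_sum_rem e_sym e_irr (setU11 v A)) AE cardsU1 vA.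
suff : 0 < dg e (v |: A) v by lia.
by rewrite card_gt0; apply/set0Pn; exists u; rewrite !inE uA e_sym euv orbT.
Qed.

Lemma cycle_degree_sum c : ucycle e c -> 2 < size c ->
  #|[set x in c]|.*2 <= degree_sum e [set x in c].
Proof.
move=> uc c2; rewrite -muln2 -sum_nat_const; apply: leq_sum => u; rewrite inE => uc'.
have [i s rc] := rot_to uc'.
have /andP[cyc uq] : ucycle e (u :: s) by rewrite -rc rot_ucycle.
have sz : 2 < size (u :: s) by rewrite -rc size_rot.
have mc v : v \in u :: s -> v \in c by rewrite -rc mem_rot.
case: s rc cyc uq sz mc => [|v [|z s]] // rc cyc uq _ mc.
have euv : e u v by case/andP: cyc.
have eul : e u (last z s).
  by move: cyc; rewrite /= rcons_path => /and4P[_ _ _]; rewrite e_sym.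
have vl : v != last z s.
  by case/and3P: uq => _ + _; apply: contraNneq => ->; apply: mem_last.
have <- : #|[set v; last z s]| = 2 by rewrite cards2 vl.
apply: subset_leq_card; apply/subsetP => y; rewrite !inE => /orP[]/eqP->.
  by rewrite euv mc // !inE eqxx orbT.
by rewrite eul mc // inE (in_cons v) mem_last !orbT.
Qed.

End Cycles.

Lemma connected_cut (G : sgraph) : connected G -> cut_connected (@adj G) [set: G].
Proof.
move=> con A _ /set0Pn[x xA] AT.
have [/existsP[u /existsP[v /and3P[uA vA euv]]]|/existsPn no] :=
  boolP [exists u, exists v, [&& u \in A, v \notin A & adj u v]].
  by exists u, v.
have cl : closed (@adj G) (mem A).
  have imp u v : adj u v -> u \in A -> v \in A.
    move=> euv uA; have /existsPn/(_ v) := no u.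
    by rewrite uA euv andbT negbK.
  by move=> u v euv; apply/idP/idP; apply: imp; rewrite // adj_sym.
case/eqP: AT; apply/setP => y; rewrite inE.
by rewrite -(closed_connect cl (con x y)).
Qed.

(** Without one edge of its only cycle the graph is acyclic, hence has at most
    n - 1 edges left; conversely the cycle has as many edges as vertices, and
    every further vertex brings an edge by connectedness. *)
Lemma unicyclic_degree_sum (G : sgraph) : unicyclic G ->
  degree_sum (@adj G) [set: G] = (#|G|.*2)%N.
Proof.
case=> con [C [[c [uc c2 CE]] Cuniq]].
apply/eqP; rewrite eqn_leq; apply/andP; split; last first.
  apply: (degree_sum_grow (@adj_sym G) (@adj_irr G) (connected_cut con)
    _ (cycle_degree_sum (@adj_sym G) uc c2)).
  by case: c uc c2 CE => // x c _ _ _; apply/set0Pn; exists x; rewrite !inE eqxx.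
have [a ac] : exists a, a \in c by case: c uc c2 CE => // a c; exists a; rewrite inE eqxx.
pose b := next c a.
pose e' (x y : G) := adj x y && ([set x; y] != [set a; b]).
have e'sym : symmetric e' by move=> x y; rewrite /e' adj_sym setUC.
have e'irr : irreflexive e' by move=> x; rewrite /e' adj_irr.
have acyc (c' : seq G) : ucycle e' c' -> (size c' <= 2)%N.
  case/andP => cyc' uq'; rewrite leqNgt; apply/negP => c'2.
  have uc' : ucycle (@adj G) c'.
    by rewrite /ucycle uq' andbT; apply: sub_cycle cyc' => x y /andP[].
  have abC : [set a; b] \in C by rewrite CE; apply/imsetP; exists a.
  have EC : C = [set [set x; next c' x] | x in c'] by apply: Cuniq; exists c'.
  move: abC; rewrite EC => /imsetP[x xc' abE].
  by have := next_cycle cyc' xc'; rewrite /e' -abE eqxx andbF.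
have T0 : [set: G] != set0 by apply/set0Pn; exists a; rewrite inE.
have := acyclic_degree_sum e'sym e'irr acyc T0; rewrite cardsT; apply: leq_trans.
have two (x y : G) : (\sum_u \sum_v ((u == x) && (v == y)) = 1)%N.
  rewrite (bigD1 x) //= [X in (_ + X)%N]big1 => [|u /negPf ux]; last first.
    by rewrite big1 // => v _; rewrite ux.
  rewrite (bigD1 y) //= big1 ?eqxx // => v /negPf vy.
  by rewrite vy andbF.
have -> : 2%N = (\sum_u \sum_v ((u == a) && (v == b)) +
                 \sum_u \sum_v ((u == b) && (v == a)))%N by rewrite !two.
rewrite -big_split /= /degree_sum.
have -> : (\sum_(u in [set: G]) dg e' [set: G] u = \sum_u dg e' [set: G] u)%N.
  by apply: eq_bigl => u; rewrite inE.
have -> : (\sum_(u in [set: G]) dg (@adj G) [set: G] u = \sum_u dg (@adj G) [set: G] u)%N.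
  by apply: eq_bigl => u; rewrite inE.
rewrite -big_split /=; apply: leq_sum => u _.
rewrite -big_split /= !dgE big_mkcond [X in (_ <= X + _)%N]big_mkcond -big_split /=.
apply: leq_sum => v _; rewrite !inE /e'.
have [uv|] := boolP (adj u v) => //=.
have [E|] := eqVneq [set u; v] [set a; b]; last by [].
have : u \in [set a; b] by rewrite -E !inE eqxx.
have : v \in [set a; b] by rewrite -E !inE eqxx orbT.
rewrite !inE => /orP[]/eqP vE /orP[]/eqP uE; move: uv;
  by rewrite uE vE ?adj_irr // !eqxx /= ?addn0 ?leq_addl.
Qed.

(** * Diametral paths *)

(** A walk that attains the diameter is minimal between its ends, so a shortcut
    between two of its vertices would contradict its length. *)
Lemma diametral_geodesic (G : sgraph) (d : nat) :
  diameter G = d -> (0 < d < #|G|)%N -> exists p, geodesic (@adj G) p d.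
Proof.
move=> diam /andP[d0 dG].
have G0 : (0 < #|G|)%N by apply: leq_trans dG.
have [u ud] := @bigop.eq_bigmax _ (fun u : G => \max_(v : G) dist u v)%N G0.
have [v vd] := @bigop.eq_bigmax _ (dist u) G0.
have duv : dist u v = d by rewrite -diam /diameter ud vd.
pose a k := [exists s : k.-tuple G, path (@adj G) u s && (last u s == v)].
have hasa : has a (iota 0 #|G|) by rewrite has_find size_iota -/(dist u v) duv.
have ad : a d.
  have := nth_find 0%N hasa; rewrite -/(dist u v) duv nth_iota //.
have mind (s : seq G) : path (@adj G) u s -> last u s = v -> (d <= size s)%N.
  move=> ps ls; rewrite leqNgt; apply/negP => lt.
  have lt' : (size s < find a (iota 0 #|G|))%N by rewrite -/(dist u v) duv.
  have := before_find 0%N lt'; rewrite nth_iota ?(ltn_trans lt) // add0n.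
  by move/negbT/existsP; case; exists (in_tuple s); rewrite ps ls eqxx.
case/existsP: ad => t /andP[pt /eqP lt]; have st := size_tuple t.
pose p i := nth u (u :: t) i.
have lastE i : (i <= d)%N -> last u (take i t) = p i.
  by move=> id; rewrite (last_nth u) size_takel ?st // /p -[u :: take i t]/(take i.+1 (u :: t)) nth_take.
have cut i : (i <= d)%N ->
    path (@adj G) u (take i t) && path (@adj G) (p i) (drop i t) /\ last (p i) (drop i t) = v.
  move=> id; have := pt; rewrite -{1}(cat_take_drop i t) cat_path lastE // => ->.
  by split=> //; rewrite -lt -{2}(cat_take_drop i t) last_cat lastE.
(* A walk between two vertices of the path replaces the part between them. *)
have short i j (q : seq G) : (i <= d)%N -> (j <= d)%N ->
    path (@adj G) (p i) q -> last (p i) q = p j -> (j <= i + size q)%N.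
  move=> id jd pq lq.
  have [/andP[pi _] _] := cut i id; have [/andP[_ pj] lj] := cut j jd.
  have := mind (take i t ++ q ++ drop j t).
  rewrite !cat_path lastE // pi pq lq pj !last_cat lastE // lq lj => /(_ isT erefl).
  by rewrite !size_cat size_takel ?st // size_drop st; lia.
have adjp i : (i < d)%N -> adj (p i) (p i.+1).
  by move=> id; apply: (pathP u pt); rewrite st.
exists p; split=> //.
- move=> i j id jd pij; apply/eqP; rewrite eqn_leq.
  have := short i j [::] id jd isT pij; have := short j i [::] jd id isT (esym pij).
  by rewrite !addn0 => -> ->.
- move=> i j id jd eij; have := short i j [:: p j] id jd.
  by rewrite /= eij addn1; apply.
- move=> x i j id jd exi exj; have := short i j [:: x; p j] id jd.
  by rewrite /= adj_sym exi exj addn2; apply.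
Qed.

(** * From induced subgraphs back to graphs *)

Lemma dg_setT (G : sgraph) (u : G) : dg (@adj G) [set: G] u = deg u.
Proof. by apply: eq_card => v; rewrite !inE. Qed.

Section Transfer.
Set Implicit Arguments.
Unset Strict Implicit.
Variables (R : realType) (f : R -> R -> R).

Definition on_nat (i j : nat) : R := f i%:R j%:R.

Hypothesis f_sym : forall x y : R, 1 <= x -> 1 <= y -> f x y = f y x.

(** [BID] sums each edge in the orientation that increases the enumeration rank;
    the sum over the other orientation is the same by symmetry of f. *)
Lemma weight_BID (G : sgraph) : weight on_nat (@adj G) [set: G] = 2 * BID f G.
Proof.
have -> : weight on_nat (@adj G) [set: G] =
    \sum_(a : G * G | adj a.1 a.2) f (deg a.1)%:R (deg a.2)%:R.
  rewrite -(pair_big_dep xpredT (fun u v : G => adj u v)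
    (fun u v : G => f (deg u)%:R (deg v)%:R)) /=.
  apply: eq_big => u; first by rewrite inE.
  by move=> _; apply: eq_big => v; rewrite ?inE // !dg_setT.
rewrite (bigID (fun a : G * G => enum_rank a.1 < enum_rank a.2)%N) /=.
rewrite -/(BID f G) mulr2n mulrDl !mul1r; congr (_ + _).
rewrite (reindex_inj (h := fun a : G * G => (a.2, a.1))) /=; last first.
  by move=> [a b] [c d] [-> ->].
apply: eq_big => [[u v]|[u v] /andP[euv _]] /=.
  rewrite adj_sym; have [euv|//] := boolP (adj u v); rewrite /= -leqNgt leq_eqVlt.
  rewrite orb_idl // => /eqP/val_inj/enum_rank_inj uv.
  by rewrite uv adj_irr in euv.
have deg1 (x y : G) : adj x y -> 1 <= (deg x)%:R :> R.
  by move=> exy; rewrite ler1n card_gt0; apply/set0Pn; exists y; rewrite inE.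
have evu : adj v u by [].
by rewrite f_sym //; [apply: deg1 evu|apply: (deg1 _ v); rewrite adj_sym].
Qed.

Lemma isomorphic_BID (G H : sgraph) : isomorphic G H -> BID f G = BID f H.
Proof.
case=> h bij_h adj_h; apply: (@mulfI _ 2); first by rewrite pnatr_eq0.
have [h' hK h'K] := bij_h.
have degE u : deg (h u) = deg u.
  rewrite /deg -(card_imset _ (can_inj h'K)); apply: eq_card => v.
  rewrite inE; apply/imsetP/idP => [[w + ->]|euv]; first by rewrite inE -adj_h h'K.
  by exists (h v); rewrite ?hK // inE adj_h.
rewrite -!weight_BID /weight [RHS](reindex h) /=; last exact: onW_bij.
apply: eq_big => u; first by rewrite !inE.
move=> _; rewrite [RHS](reindex h) /=; last exact: onW_bij.
by apply: eq_big => v; rewrite !inE ?adj_h // !dg_setT !degE.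
Qed.

End Transfer.

Section Und.
Set Implicit Arguments.
Unset Strict Implicit.
Variables (n d : nat).
Hypotheses (d4 : (4 <= d)%N) (nd : (d + 2 <= n)%N).

Lemma Und_und_shape : exists p w, und_shape (@adj (Und n d)) d p [set: Und n d] w.
Proof.
case: n nd => [|m] md; first by lia.
pose p i : Und m.+1 d := inord i; pose w : Und m.+1 d := inord d.+1.
have pK i : (i <= d)%N -> nat_of_ord (p i) = i by move=> id; rewrite inordK //; lia.
have wK : nat_of_ord w = d.+1 by rewrite inordK //; lia.
have adjE (x y : Und m.+1 d) : adj x y =
  (nat_of_ord x != y) && (Und_arc d x y || Und_arc d y x) by [].
have pE (x : Und m.+1 d) i : (i <= d)%N -> (x == p i) = (nat_of_ord x == i).
  by move=> id; rewrite -(inj_eq val_inj) /= pK.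
exists p, w; split.
- split.
  + by move=> i id; rewrite adjE !pK /Und_arc; lia.
  + by move=> i j id jd /(congr1 (@nat_of_ord _)); rewrite !pK.
  + by move=> i j id jd; rewrite adjE !pK // /Und_arc; lia.
  + by move=> x i j id jd; rewrite !adjE !pK // /Und_arc; lia.
- exact: subsetT.
- by rewrite inE.
- by apply/negP => /traceP[k kd /(congr1 (@nat_of_ord _))]; rewrite wK pK; lia.
- by move=> u _; rewrite adjE wK !pE; [rewrite /Und_arc|..]; lia.
- move=> q u _ qt qw _; rewrite adjE pE; last by lia.
  have qd : (d.+2 <= q)%N.
    rewrite ltnNge; apply/negP => le; have [qd|qd] := leqP q d.
      by case/negP: qt; apply/traceP; exists (nat_of_ord q); rewrite // -[LHS]inord_val.
    by case/eqP: qw; apply: val_inj; rewrite /= wK; apply/eqP; lia.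
  by rewrite /Und_arc; lia.
Qed.

(** The isomorphism sends a vertex to its position in the list made of the path,
    then w, then the pendant vertices off the path: this is the numbering of
    the vertices of [Und]. *)
Lemma und_shape_isomorphic (G : sgraph) p w : #|G| = n ->
  und_shape (@adj G) d p [set: G] w -> isomorphic G (Und n d).
Proof.
move=> cG sh; have geo := shape_geo sh; have off := shape_off sh.
pose Q := enum ((~: trace p d) :\ w).
pose s := map p (iota 0 d.+1) ++ w :: Q.
have memp k : (k <= d)%N -> p k \in map p (iota 0 d.+1).
  by move=> kd; apply: map_f; rewrite mem_iota; lia.
have mapP' x : (x \in map p (iota 0 d.+1)) = (x \in trace p d).
  apply/mapP/traceP => [[k]|[k kd ->]]; first by rewrite mem_iota add0n ltnS => kd ->; exists k.
  by exists k; rewrite // mem_iota add0n ltnS.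
have s_all x : x \in s.
  rewrite mem_cat mapP' inE mem_enum !inE.
  by case: (x \in trace p d) => //=; case: (x == w).
have s_uniq : uniq s.
  rewrite cat_uniq map_inj_in_uniq ?iota_uniq => [|i j]; last first.
    rewrite !mem_iota => id jd /eqP; rewrite (geodesic_eq geo); [by move/eqP|lia|lia].
  rewrite cons_uniq enum_uniq mem_enum !inE eqxx andbT /= mapP' negb_or off /=.
  rewrite andbT; apply/hasPn => x; rewrite mem_enum => /setD1P[_].
  by rewrite in_setC -mapP'.
have s_size : size s = n.
  by rewrite -cG -(card_uniqP s_uniq); apply: eq_card => x; rewrite s_all.
have idx x : (index x s < n)%N by rewrite -s_size index_mem.
pose h (x : G) : Und n d := Ordinal (idx x).
have h_inj : injective h.
  move=> x y hxy; have E : index x s = index y s := congr1 (@nat_of_ord _) hxy.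
  by rewrite -(nth_index w (s_all x)) E nth_index.
have idx_p k : (k <= d)%N -> index (p k) s = k.
  move=> kd; rewrite index_cat memp // -[X in index X]/(p k).
  rewrite -{1}(add0n k) -(nth_iota 0%N 0 (n := d.+1)) //.
  rewrite -(nth_map 0%N (p 0) p) ?size_iota // index_uniq ?size_map ?size_iota //.
  by move: s_uniq; rewrite cat_uniq => /andP[].
have idx_w : index w s = d.+1.
  by rewrite index_cat mapP' (negPf off) size_map size_iota /= eqxx addn0.
have idx_q q : q \notin trace p d -> q != w -> (d.+2 <= index q s)%N.
  move=> qt qw; rewrite index_cat mapP' (negPf qt) size_map size_iota /= eq_sym (negPf qw).
  by lia.
have kind x : [\/ exists2 k, (k <= d)%N & x = p k, x = w | x \notin trace p d /\ x != w].
  by apply: (@shape_cases _ d p [set: G] w); rewrite inE.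
exists h; first by apply: inj_card_bij => //; rewrite cG card_ord.
have topE u : adj w u = (u == p 1%N) || (u == p 3%N) by apply: (shape_top sh); rewrite inE.
have restE q u : q \notin trace p d -> q != w -> adj q u = (u == p 1%N).
  by move=> qt qw; apply: (shape_rest sh); rewrite ?inE.
have pN q k : q \notin trace p d -> (k <= d)%N -> (q == p k) = false.
  by move=> qt kd; apply: contraNF qt => /eqP->; apply: mem_trace.
have hE x y : adj (h x) (h y) =
  (index x s != index y s) && (Und_arc d (index x s) (index y s) || Und_arc d (index y s) (index x s)).
  by [].
have adjC (x y : G) : adj x y = adj y x by apply: adj_sym.
move=> x y; rewrite hE.
case: (kind x) => [[k kd ->]|->|[xt xw]]; case: (kind y) => [[l ld ->]|->|[yt yw]].
- by rewrite !idx_p // (geodesic_adj (@adj_sym G) (@adj_irr G) geo) // /Und_arc; lia.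
- rewrite idx_p // idx_w adjC topE !(geodesic_eq geo) //; [|lia|lia].
  by rewrite /Und_arc; lia.
- rewrite idx_p // adjC restE // (geodesic_eq geo) //; last by lia.
  by have := idx_q y yt yw; rewrite /Und_arc; lia.
- rewrite idx_p // idx_w topE !(geodesic_eq geo) //; [|lia|lia].
  by rewrite /Und_arc; lia.
- by rewrite eqxx adj_irr.
- rewrite idx_w topE !pN //; [|lia|lia].
  by have := idx_q y yt yw; rewrite /Und_arc; lia.
- rewrite idx_p // restE // (geodesic_eq geo) //; last by lia.
  by have := idx_q x xt xw; rewrite /Und_arc; lia.
- rewrite idx_w restE // pN //; last by lia.
  by have := idx_q x xt xw; rewrite /Und_arc; lia.
- rewrite restE // pN //; last by lia.
  by have := idx_q x xt xw; have := idx_q y yt yw; rewrite /Und_arc; lia.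
Qed.

End Und.

Theorem theorem3p13 (R : realType) (n d : nat)
    (hd : (4 <= d)%N) (hn : (d + 2 <= n)%N) (f : R -> R -> R)
    (f_sym : forall x y : R, 1 <= x -> 1 <= y -> f x y = f y x)
    (f_incr : forall x x' y : R, 1 <= x -> 1 <= y -> x < x' -> f x y < f x' y)
    (f_shift : forall x y : R, 2 <= y -> y <= x -> f x y < f (x + 1) (y - 1))
    (f1_convex : strictly_convex_from1 (fun x => f 1 x))
    (f2_convex : strictly_convex_from1 (fun x => f 2 x))
    (phi_incr : forall x x' y : R,
       2 <= x -> 1 <= y -> x < x' -> phi f x y < phi f x' y)
    (phi_decr : forall x y y' : R,
       2 <= x -> 1 <= y -> y < y' -> phi f x y' < phi f x y)
    (G : sgraph) (hG : unicyclic_nd n d G) :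
  BID f G <= BID f (Und n d) /\
  (BID f G = BID f (Und n d) <-> isomorphic G (Und n d)).
Proof.
case: hG => uni cG diam.
have incE i j : (1 < i)%N -> inc (on_nat f) i j = phi f i%:R j%:R.
  case: i => // i _; rewrite /inc /on_nat /phi /=.
  by have -> : i.+1%:R - 1 = i%:R :> R by rewrite -natr1 addrK.
have esc : escalating (on_nat f).
  split=> [i j i0 j0|i i' j i0 j0 ii'||i i' j i1 j0 ii'|i j j' i1 j0 jj'].
  - by apply: f_sym; rewrite ler1n.
  - by apply: f_incr; rewrite ?ler1n ?ltr_nat.
  - have E3 : (2 + 1 : R) = 3%:R by ring.
    have E1 : (2 - 1 : R) = 1%:R by ring.
    by rewrite /on_nat -E3 -E1; apply: f_shift.
  - rewrite !incE //; last exact: ltn_trans ii'.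
    by apply: phi_incr; rewrite ?ler1n ?ler_nat ?ltr_nat.
  - by rewrite !incE //; apply: phi_decr; rewrite ?ler1n ?ler_nat ?ltr_nat.
have [p geo] : exists p, geodesic (@adj G) p d.
  by apply: diametral_geodesic => //; rewrite cG; lia.
have gG : unicyclic_part (@adj G) d p [set: G].
  split; first exact: subsetT.
    by apply: connected_cut; case: uni.
  by rewrite cardsT; apply: unicyclic_degree_sum.
have nE (H : sgraph) : #|H| = n -> #|[set: H]| = (d + 2 + (n - (d + 2)))%N.
  by rewrite cardsT => ->; lia.
have [le eq_shape] := part_weight_le esc (@adj_sym G) (@adj_irr G) hd geo gG (nE G cG).
have [q [w shU]] := Und_und_shape hd hn.
have := shape_weight esc (@adj_sym (Und n d)) (@adj_irr (Und n d)) hd shU (nE (Und n d) (card_ord n)).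
move: le eq_shape; rewrite !weight_BID // => le eq_shape /(mulfI _) valU.
rewrite valU ?pnatr_eq0 //; split; first by rewrite -(@ler_pM2l _ 2).
split=> [E|iso]; last by rewrite -valU ?pnatr_eq0 //; apply: isomorphic_BID.
have [|p' [w' sh]] := eq_shape; first by rewrite E.
exact: und_shape_isomorphic sh.
Qed.
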